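(* Let $\beta,k$ be positive integers. Then the exact degree in $x^{-1}$ of the polynomial $z(\chi_t^\beta,x,-k)$ is $$\phi(\beta,k):=\min_{0\leq i<\log_p(q)}\left\lfloor \frac{l(p^i\beta)+l(p^ik)}{q-1}\right\rfloor .$$
   Context: Let $q=p^n$ be a power of a prime $p$, $A=\mathbb{F}_q[\theta]$, and $A_+(d)$ the set of monic polynomials in $A$ of degree $d$. Let $t$ be an indeterminate and $\chi_t:A\to\mathbb{F}_q[t]$ the $\mathbb{F}_q$-algebra morphism with $\theta\mapsto t$. For non-negative integers $\beta,k,d$ let $S_d(\chi_t^\beta,k):=\sum_{a\in A_+(d)}\chi_t(a)^\beta a^k\in A[t]$; these vanish for $d$ large, and $z(\chi_t^\beta,x,-k):=\sum_{d\ge0}x^{-d}S_d(\chi_t^\beta,k)\in A[t][x^{-1}]$. For a positive integer $\alpha=\sum_i a_iq^i$ written in base $q$ ($0\le a_i\le q-1$), $l(\alpha):=\sum_i a_i$ is the sum of its base-$q$ digits. The index $i$ in the minimum ranges over $0,1,\dots,n-1$. *)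

(* Defs.v *)
From HB Require Import structures.
From mathcomp Require Import all_boot all_order all_algebra.
Set Implicit Arguments. Unset Strict Implicit. Unset Printing Implicit Defensive.
Import GRing.Theory.
Local Open Scope ring_scope.

(* Sum of the base-b digits of m (fuel-based; fuel m suffices for b >= 2). *)
Fixpoint digsum_aux (fuel b m : nat) : nat :=
  match fuel with
  | 0 => 0
  | f.+1 => if m == 0 then 0 else (m %% b + digsum_aux f b (m %/ b))%N
  end.
Definition digsum (b m : nat) : nat := digsum_aux m b m.

Definition monic_of (F : fieldType) (d : nat) (c : {ffun 'I_d -> F}) : {poly F} :=
  'X^d + \sum_(i < d) c i *: 'X^i.

(* chi_t : A = F[theta] -> F[t] subset A[t], theta |-> t.
   A[t] is {poly {poly F}}: outer variable t, coefficients in A. *)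
Definition chi_t (F : fieldType) (a : {poly F}) : {poly {poly F}} :=
  map_poly (fun c : F => c%:P) a.

Definition S_d (F : finFieldType) (beta k d : nat) : {poly {poly F}} :=
  \sum_(c : {ffun 'I_d -> F})
     chi_t (monic_of c) ^+ beta * (monic_of c)%:P ^+ k.

(* Exact degree in x^{-1} of z = sum_d x^{-d} S_d : the largest d with S_d <> 0. *)
Definition is_exact_degree_z (F : finFieldType) (beta k D : nat) : Prop :=
  S_d F beta k D != 0 /\ forall d, (D < d)%N -> S_d F beta k d = 0.

Definition phi (p n beta k : nat) : nat :=
  let q := (p ^ n)%N in
  \big[minn/((digsum q beta + digsum q k) %/ (q - 1))%N]_(i < n)
     ((digsum q (p ^ i * beta) + digsum q (p ^ i * k)) %/ (q - 1))%N.

(* Main.v *)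
Require Import Defs.
From HB Require Import structures.
From mathcomp Require Import all_boot all_order all_algebra.
From mathcomp Require Import all_fingroup all_solvable all_field zify.
Set Implicit Arguments. Unset Strict Implicit. Unset Printing Implicit Defensive.

(** Put q = p^n. Expanding a^m as a product of one factor a^(p^b) per unit of the
    b-th base-p digit of m (a "token" of value p^b, type b mod n and cost p^(b mod n)),
    the sum of a^m over the monic a of degree D becomes a sum over the ways to
    distribute the tokens among the coefficients of a; a distribution survives only if
    each of the D free coefficients receives a positive cost divisible by q - 1. If the
    total cost l(m) is less than D(q - 1), nothing survives. Frobenius makes l minimal
    among the l(p^i m), and the substitution t = theta^(q^N) reduces S_D to one variable.

    Let l(m) = D(q - 1) + R with R < q - 1 and l(p^i m) >= D(q - 1) for all i. Then the
    surviving distributions give cost exactly q - 1 to each free coefficient, and each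
    contributes (-1)^D theta^w with w its weight. Those of maximal weight differ only by
    permuting equal tokens, so their number divides a product of factorials of digits
    and is prime to p: the sum is not 0.

    For the uniqueness, record how many tokens of each type lie in the top i + 1 groups;
    by the cost condition this is encoded by carry vectors K i, nondecreasing in i, and
    the weight is bounded by a sum of concave functions of the K i, which is supermodular.
    Two optima may thus be taken comparable; at the first level where they differ, trading
    one token for cheaper ones of the same total cost is a gain, and performing the same
    trade at all later levels loses less than that gain, because the tokens concerned
    drop by a factor q from one level to the next. *)

(** * Arithmetic of exchanging units between two levels *)

(** Two levels have carries x and x + y in one type, and X and X + Y are p times their carries in
    the next type; the levels differ by m + Y - y. The exchange passes E - e units from the second
    to the first, at most that difference (none if it is negative), so the smaller level does not
    decrease. *)
Lemma exchange_below R m X x Y y E e : x <= R + X -> x + y <= m + R + (X + Y) ->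
  e <= y -> E <= Y -> e = E - (m + Y - y) ->
  [/\ x + e <= R + (X + E), x + y - e <= m + R + (X + Y - E) &
   [/\ R + X - x + (m + R + (X + Y) - (x + y)) =
       R + (X + E) - (x + e) + (m + R + (X + Y - E) - (x + y - e)),
     minn (R + X - x) (m + R + (X + Y) - (x + y)) <= R + (X + E) - (x + e) &
     minn (R + X - x) (m + R + (X + Y) - (x + y)) <= m + R + (X + Y - E) - (x + y - e)]].
Proof. by move=> h1 h2 h3 h4 h5; split; try split; lia.
Qed.
(** At the type where a chain starts, one unit passes from the first level to the second, which the
    last hypothesis makes the smaller one. *)
Lemma exchange_top R m X x Y y : x <= R + X -> x + y <= m + R + (X + Y) -> m.+1 + Y <= y ->
  [/\ x + 1 <= R + (X + 0), x + y - 1 <= m + R + (X + Y - 0) &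
   [/\ R + X - x + (m + R + (X + Y) - (x + y)) =
       R + (X + 0) - (x + 1) + (m + R + (X + Y - 0) - (x + y - 1)),
     minn (R + X - x) (m + R + (X + Y) - (x + y)) <= R + (X + 0) - (x + 1) &
     minn (R + X - x) (m + R + (X + Y) - (x + y)) <= m + R + (X + Y - 0) - (x + y - 1)]].
Proof. by move=> h1 h2 h3; split; try split; lia.
Qed.

Lemma exchange_lattice R X Y x y : x <= R + X -> y <= R + Y ->
  [/\ minn x y <= R + minn X Y, maxn x y <= R + maxn X Y &
   [/\ R + X - x + (R + Y - y) = R + minn X Y - minn x y + (R + maxn X Y - maxn x y),
     minn (R + X - x) (R + Y - y) <= R + minn X Y - minn x y &
     minn (R + X - x) (R + Y - y) <= R + maxn X Y - maxn x y]].
Proof. by move=> h1 h2; split; try split; lia. Qed.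

Lemma sum_replace2 (m i : nat) (g h : nat -> nat) : i.+1 < m ->
  (forall l, l != i -> l != i.+1 -> g l = h l) ->
  \sum_(l < m) g l + (h i + h i.+1) = \sum_(l < m) h l + (g i + g i.+1).
Proof.
move=> lt_im gh; have lt_im' := ltnW lt_im.
have ne : Ordinal lt_im != Ordinal lt_im' by rewrite -val_eqE /= neq_ltn ltnSn orbT.
have E (f : nat -> nat) : \sum_(l < m) f l = f i + (f i.+1 +
    \sum_(l < m | (l != Ordinal lt_im') && (l != Ordinal lt_im)) f l).
  by rewrite (bigD1 (Ordinal lt_im')) //= (bigD1 (Ordinal lt_im)).
rewrite !E (eq_bigr (fun l : 'I_m => h l)) => [|l /andP[l1 l2]]; last exact: gh.
by move: (\sum_(l < m | _) _) => x; lia.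
Qed.

(** * Chains *)

Section Chain.
Variable p : nat.

(* [chain a cap] breaks one unit of type [a] into [p] units of type [a.-1], keeps at most
   [cap] of them, breaks the others, and so on: [chain a cap j] units of type [j] are broken. *)
Fixpoint chain_down (a : nat) (cap : nat -> nat) (t : nat) : nat :=
  if t is t'.+1 then p * chain_down a cap t' - cap (a - t) else 1.

Definition chain a cap j := if j <= a then chain_down a cap (a - j) else 0.

Lemma chain_top a cap : chain a cap a = 1.
Proof. by rewrite /chain leqnn subnn. Qed.

Lemma chain_above a cap j : a < j -> chain a cap j = 0.
Proof. by rewrite ltnNge /chain => /negPf->. Qed.

Lemma chain_below a cap j :
  j < a -> chain a cap j = p * chain a cap j.+1 - cap j.
Proof.
move=> lt_ja; rewrite /chain ltnW // lt_ja.
have -> : a - j = (a - j.+1).+1 by lia.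
by rewrite /=; congr (_ - cap _); lia.
Qed.

(** The cap is what [d] leaves unbroken, so a chain started by one of the [d a] units never breaks
    more than [d] does. *)
Lemma chain_le a d j : 0 < d a ->
  chain a (fun j => p * d j.+1 - d j) j <= d j.
Proof.
move=> da; have [le_ja|lt_aj] := leqP j a; last by rewrite chain_above.
rewrite -(subKn le_ja); elim: (a - j) (leq_subr j a) => [|t IHt] le_ta.
  by rewrite subn0 chain_top.
rewrite chain_below; last by lia.
have -> : (a - t.+1).+1 = a - t by lia.
have := IHt (ltnW le_ta); rewrite -(leq_pmul2l (m := p.+1)) // => H.
have: p * chain a (fun j => p * d j.+1 - d j) (a - t) <= p * d (a - t).
  by rewrite leq_mul2l IHt ?orbT // ltnW.
by lia.
Qed.

(** The factor 2 lets two carry vectors at distance [c] approach each other by the chain from both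
    sides and stay ordered. *)
Lemma chain_le_half a c j : 1 < p -> p + p * c a.+1 <= c a ->
  2 * chain a (fun j => p.-1 + p * c j.+1 - c j) j <= c j.
Proof.
move=> p1 ca; have [le_ja|lt_aj] := leqP j a; last by rewrite chain_above.
rewrite -(subKn le_ja); elim: (a - j) (leq_subr j a) => [|t IHt] le_ta.
  by rewrite subn0 chain_top; lia.
rewrite chain_below; last by lia.
have -> : (a - t.+1).+1 = a - t by lia.
set x := chain _ _ _ in IHt *.
have: p * (2 * x) <= p * c (a - t) by rewrite leq_mul2l IHt ?orbT // ltnW.
by lia.
Qed.

End Chain.

(** * Optimal profiles *)

Section Tokens.
Variables (p n B : nat) (cnt : nat -> nat).
Hypotheses (p_gt1 : 1 < p) (n_gt0 : 0 < n).
Hypotheses (cnt_lt : forall b, cnt b < p) (cnt0 : forall b, B <= b -> cnt b = 0).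

(* There are [cnt c] tokens at position [c]; [tail j b] counts those of type [j] at
   position at least [b], [topval j x] is the value of the [x] largest ones of type [j]
   (as the weights up to [b] add up to [p ^ b]), and [lowval j z] is the value of those
   below position [z]. *)
Definition tail j b := \sum_(b <= c < B | c %% n == j) cnt c.
Definition weight b := if b is b'.+1 then p ^ b - p ^ b' else 1.
Definition topval j x := \sum_(b < B) weight b * minn x (tail j b).
Definition lowval j z := \sum_(b < z | b %% n == j) cnt b * p ^ b.

Let p_gt0 : 0 < p. Proof. exact: ltnW. Qed.

Lemma sum_weight z : \sum_(b < z.+1) weight b = p ^ z.
Proof.
elim: z => [|z IHz]; first by rewrite big_ord1.
rewrite big_ord_recr IHz /= subnKC //.
by rewrite leq_exp2l.
Qed.

Lemma tailS j b : tail j b = tail j b.+1 + (b %% n == j) * cnt b.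
Proof.
rewrite /tail; have [lt_bB|le_Bb] := ltnP b B.
  rewrite big_ltn_cond //; case: eqP => _; last by rewrite mul0n addn0.
  by rewrite mul1n addnC.
by rewrite !big_geq ?(leqW le_Bb) // cnt0 // muln0.
Qed.

Lemma tail_ge j b : B <= b -> tail j b = 0.
Proof. by move=> le_Bb; rewrite /tail big_geq. Qed.

Lemma tail_le j b c : b <= c -> tail j c <= tail j b.
Proof.
move=> /subnKC <-; elim: (c - b) => [|d IHd]; first by rewrite addn0.
by apply: leq_trans IHd; rewrite addnS [tail j (b + d)]tailS leq_addr.
Qed.

Lemma tail_off j b : b %% n != j -> tail j b.+1 = tail j b.
Proof. by rewrite [RHS]tailS => /negPf->; rewrite mul0n addn0. Qed.

(** Among at most n consecutive positions at most one has type j, and it holds at most p - 1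
    tokens. *)
Lemma tail_window_aux j b k : k <= n -> tail j b <= tail j (b + k) + p.-1 /\
  ((forall i, i < k -> (b + i) %% n != j) -> tail j b <= tail j (b + k)).
Proof.
elim: k => [|k IHk] le_kn; first by rewrite addn0 leq_addr.
have [IH1 IH2] := IHk (ltnW le_kn).
have E := tailS j (b + k); rewrite -addnS in E.
have [e|ne] := eqVneq ((b + k) %% n) j; last first.
  rewrite (negPf ne) in E; split; first by lia.
  by move=> H; have := IH2 (fun i lt_ik => H i (ltnW lt_ik)); lia.
split; last by move=> /(_ k (leqnn _)); rewrite e eqxx.
have: tail j b <= tail j (b + k).
  apply: IH2 => i lt_ik; apply/negP=> /eqP e'.
  have /eqP : (b + i) = (b + k) %[mod n] by rewrite e e'.
  rewrite eqn_modDl !modn_small; [|lia|lia]; by move/eqP; lia.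
have := cnt_lt (b + k); rewrite e eqxx in E; lia.
Qed.

Lemma tail_window j b s : tail j (b - n * s) <= tail j b + p.-1 * s.
Proof.
elim: s => [|s IHs]; first by rewrite muln0 subn0 muln0 addn0.
have H : tail j (b - n * s.+1) <= tail j (b - n * s) + p.-1; last by lia.
have [le|lt] := leqP n (b - n * s).
  have [] := @tail_window_aux j (b - n * s.+1) n (leqnn n).
  by have -> : b - n * s.+1 + n = b - n * s by lia.
have -> : b - n * s.+1 = 0 by lia.
by have [] := @tail_window_aux j 0 (b - n * s) (ltnW lt).
Qed.

Lemma token_pos j r : r < tail j 0 ->
  exists b, [/\ b %% n = j, tail j b.+1 <= r & r < tail j b].
Proof.
move=> r0; have: exists b, tail j b <= r by exists B; rewrite tail_ge.
move=> /ex_minnP[[|b] le_r min_b]; first by lia.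
have lt_r : r < tail j b by rewrite ltnNge; apply/negP => /min_b; lia.
exists b; split=> //; apply/eqP; apply: contraT => /tail_off; lia.
Qed.

(** [topval j] is concave: bringing two arguments together at fixed sum loses nothing. *)
Lemma topval_exch j u v u' v' : u + v = u' + v' -> minn u v <= u' -> minn u v <= v' ->
  topval j u + topval j v <= topval j u' + topval j v'.
Proof.
move=> e hu hv; rewrite /topval -!big_split; apply: leq_sum => b _ /=.
rewrite -!mulnDr leq_mul2l; apply/orP; right; lia.
Qed.

Lemma topval_le j x y : x <= y -> topval j x <= topval j y.
Proof.
by move=> le_xy; apply: leq_sum => b _; rewrite leq_mul2l; apply/orP; right; lia.
Qed.

(** The token of rank r lies at position x or above. *)
Lemma topval_gain j x r : r < tail j x -> topval j r + p ^ x <= topval j r.+1.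
Proof.
move=> lt_r; have lt_xB : x < B.
  by rewrite ltnNge; apply/negP=> /tail_ge/= H; move: lt_r; rewrite H.
rewrite -sum_weight (big_ord_widen_cond B predT weight) //.
rewrite /topval [X in _ + X]big_mkcond -big_split; apply: leq_sum => b _ /=.
case: ifP => [lt_bx|_]; last by rewrite addn0 leq_mul2l; apply/orP; right; lia.
have le_bx: b <= x by rewrite -ltnS.
have := tail_le j le_bx => H.
by rewrite -[X in _ + X]muln1 -mulnDr leq_mul2l; apply/orP; right; lia.
Qed.

(** The tokens below z are the digits of a number with z digits in base p. Hence one token at z
    outweighs all those below it. *)
Lemma lowval_sum z : \sum_(j < n) lowval j z < p ^ z.
Proof.
have -> : \sum_(j < n) lowval j z = \sum_(b < z) cnt b * p ^ b.
  rewrite /lowval (exchange_big_dep predT) //=; apply: eq_bigr => b _.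
  by rewrite (big_pred1 (Ordinal (ltn_pmod b n_gt0))).
elim: z => [|z IHz]; first by rewrite big_ord0.
rewrite big_ord_recr /= expnS.
have: (cnt z).+1 * p ^ z <= p * p ^ z by rewrite leq_mul2r cnt_lt orbT.
by rewrite mulSn; move: IHz; set u := \sum_(_ < _) _; set v := p ^ z; set w := _ * v; lia.
Qed.

Lemma lowvalS j z : lowval j z.+1 = lowval j z + (z %% n == j) * cnt z * p ^ z.
Proof.
rewrite /lowval big_mkcond big_ord_recr /= -big_mkcond /=.
by case: eqP => _; rewrite ?mul1n.
Qed.

(** Summation by parts, the weights being the increments of the powers of p. *)
Lemma lowvalE j z : \sum_(b < z) weight b * (tail j b - tail j z) = lowval j z.
Proof.
elim: z => [|z IHz]; first by rewrite big_ord0 /lowval big_ord0.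
rewrite lowvalS -IHz -sum_weight big_distrr /= !big_ord_recr /=.
rewrite addnA -big_split /=; congr (_ + _).
  apply: eq_bigr => b _; rewrite [_ * weight b]mulnC -mulnDr; congr (_ * _).
  have := tailS j z; have := tail_le j (ltnW (ltn_ord b)); lia.
by rewrite mulnC; congr (_ * _); rewrite (tailS j z) addKn.
Qed.

(** Once all tokens at z or above are taken, only tokens below z can be added. *)
Lemma topval_small j z r r' : tail j z <= r -> topval j r' <= topval j r + lowval j z.
Proof.
move=> le_r.
have key : topval j r' <= topval j r +
    \sum_(b < B | b < z) weight b * (tail j b - tail j z).
  rewrite /topval [X in _ + X]big_mkcond -big_split; apply: leq_sum => b _ /=.
  case: ifP => [lt_bz|/negbT].
    have := tail_le j (ltnW lt_bz) => H.
    by rewrite -mulnDr leq_mul2l; apply/orP; right; lia.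
  rewrite -leqNgt => le_zb; have H := tail_le j le_zb.
  by rewrite addn0 leq_mul2l; apply/orP; right; lia.
apply: leq_trans key _; rewrite leq_add2l -lowvalE.
have [le_zB|lt_Bz] := leqP z B.
  by rewrite -(big_ord_widen_cond B predT (fun b => weight b * (tail j b - tail j z))).
rewrite (eq_bigl (fun b : 'I_B => true)) => [|b]; last by rewrite (ltn_trans (ltn_ord b)).
rewrite (big_ord_widen z (fun b => weight b * (tail j b - tail j z)) (ltnW lt_Bz)).
by rewrite [X in _ <= X](bigID (fun b : 'I_z => b < B)) /= leq_addr.
Qed.

Lemma topval_step j r b : tail j b.+1 <= r -> topval j r.+1 <= topval j r + p ^ b.
Proof.
move=> le_r; rewrite -sum_weight.
have key : topval j r.+1 <= topval j r + \sum_(c < B | c < b.+1) weight c.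
  rewrite /topval [X in _ + X]big_mkcond -big_split; apply: leq_sum => c _ /=.
  case: ifP => [_|/negbT].
    by rewrite -[X in _ + X]muln1 -mulnDr leq_mul2l; apply/orP; right; lia.
  rewrite -leqNgt => le_bc; have H := tail_le j le_bc.
  by rewrite addn0 leq_mul2l; apply/orP; right; lia.
apply: leq_trans key _; rewrite leq_add2l.
have [le_bB|lt_Bb] := leqP b.+1 B; first by rewrite -(big_ord_widen_cond B predT weight).
rewrite (eq_bigl (fun c : 'I_B => true)) => [|c]; last by rewrite (ltn_trans (ltn_ord c)).
rewrite (big_ord_widen b.+1 weight (ltnW lt_Bb)).
by rewrite [X in _ <= X](bigID (fun c : 'I_b.+1 => c < B)) /= leq_addr.
Qed.

Variables (D : nat) (r C : nat -> nat).
Hypotheses (C_0 : C 0 = 0) (C_n : C n = 0).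
(** Base-p form of the identity total cost = R + D(q - 1): multiplying by p^j and adding over j
    cancels the carries. *)
Hypothesis tail_C : forall j, j < n -> tail j 0 + C j = r j + D * p.-1 + p * C j.+1.

(* [level i k j] is the number of tokens of type [j] in the top [i.+1] groups when [k] is
   the vector of carries between the types; [r] holds the digits of the cost of the top
   group. Ranks beyond [tail j 0] stand for tokens of value 0. *)
Definition level i (k : nat -> nat) j := r j + i * p.-1 + p * k j.+1 - k j.
Definition okvec i k :=
  [/\ k 0 = 0, forall j, n <= j -> k j = 0 & forall j, j < n -> k j <= r j + i * p.-1 + p * k j.+1].
Definition levval i k := \sum_(j < n) topval j (level i k j).
Definition feasible (K : nat -> nat -> nat) :=
  [/\ forall i, i <= D -> okvec i (K i), forall i j, i < D -> K i j <= K i.+1 j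
    & forall j, j <= n -> K D j = C j].
Definition total (K : nat -> nat -> nat) := \sum_(i < D.+1) levval i (K i).
Definition flat (K : nat -> nat -> nat) :=
  forall i j, i < D -> j < n -> level i (K i) j <= level i.+1 (K i.+1) j.

Lemma levval_exch i i' k l k' l' :
  (forall j, j < n -> [/\ level i k j + level i' l j = level i k' j + level i' l' j,
     minn (level i k j) (level i' l j) <= level i k' j
   & minn (level i k j) (level i' l j) <= level i' l' j]) ->
  levval i k + levval i' l <= levval i k' + levval i' l'.
Proof.
move=> H; rewrite /levval -!big_split; apply: leq_sum => j _ /=.
by have [e h1 h2] := H j (ltn_ord j); apply: topval_exch.
Qed.

Lemma feasible_le K i l j : feasible K -> i <= l -> l <= D -> K i j <= K l j.
Proof.
move=> [_ mono _] /subnKC <-; elim: (l - i) => [|d IHd]; first by rewrite addn0.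
rewrite addnS => lt_D; exact: leq_trans (IHd (ltnW lt_D)) (mono _ _ lt_D).
Qed.

Lemma feasible_leC K i j : feasible K -> i <= D -> j <= n -> K i j <= C j.
Proof.
move=> fK le_iD le_jn; have [_ _ eC] := fK.
by rewrite -eC //; apply: feasible_le.
Qed.

(** Measure for the termination of the flattening. *)
Let spread (K : nat -> nat -> nat) := \sum_(i < D.+1) \sum_(j < n.+1) (C j - K i j) ^ 2.

(* A drop of [level] at [a] between [i] and [i.+1] is repaired by shifting [K i] up and
   [K i.+1] down along a chain; concavity makes this free. *)
Lemma flatten_step K i a : feasible K -> i < D -> a < n ->
  level i.+1 (K i.+1) a < level i (K i) a ->
  exists K', [/\ feasible K', total K <= total K' & spread K' < spread K].
Proof.
move=> fK lt_iD lt_an drop; have [ok mono eC] := fK.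
have [k0 kn kle] := ok i (ltnW lt_iD); have [l0 ln lle] := ok i.+1 lt_iD.
have mono_i := fun j => mono i j lt_iD.
pose c j := K i.+1 j - K i j.
have Ec j : K i.+1 j = K i j + c j by rewrite /c subnKC.
have lvi j : r j + i.+1 * p.-1 = p.-1 + (r j + i * p.-1) by rewrite mulSn addnCA.
have pE : p.-1.+1 = p by rewrite prednK.
(* The surplus of level i.+1 over level i in type j, which bounds how much may pass to level i
   there. *)
pose cap j := p.-1 + p * c j.+1 - c j.
pose d := chain p a cap.
have ca : p.-1.+1 + p * c a.+1 <= c a.
  move: drop (kle a lt_an) (lle a lt_an); rewrite /level !Ec lvi mulnDr.
  by move: (r a + i * p.-1) (p.-1) (p * _) (p * _) (K i a) (c a) => *; lia.
have d2 j : 2 * d j <= c j by apply: chain_le_half => //; rewrite -{1}pE.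
have da : d a = 1 by apply: chain_top.
have dabove j : a < j -> d j = 0 by apply: chain_above.
have dbelow j : j < a -> d j = p * d j.+1 - cap j by apply: chain_below.
have d0 : d 0 = 0 by have := d2 0; rewrite /c k0 l0; lia.
have dn j : n <= j -> d j = 0 by move=> le_nj; rewrite dabove // (leq_trans lt_an).
pose up j := K i j + d j; pose dn' j := K i.+1 j - d j.
have lev j : j < n -> [/\ up j <= r j + i * p.-1 + p * up j.+1,
    dn' j <= r j + i.+1 * p.-1 + p * dn' j.+1 &
    [/\ level i (K i) j + level i.+1 (K i.+1) j = level i up j + level i.+1 dn' j,
     minn (level i (K i) j) (level i.+1 (K i.+1) j) <= level i up j
   & minn (level i (K i) j) (level i.+1 (K i.+1) j) <= level i.+1 dn' j]].
  move=> lt_jn; have := kle j lt_jn; have := lle j lt_jn.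
  rewrite /level /up /dn' !Ec lvi mulnBr !mulnDr.
  have [lt_ja|gt_ja|e_ja] := ltngtP j a.
  - move=> h1 h2; apply: exchange_below => //; last exact: dbelow.
      by have := d2 j; lia.
    by rewrite leq_pmul2l //; have := d2 j.+1; lia.
  - rewrite (dabove j) // (dabove j.+1) ?muln0 ?addn0 ?subn0 ?geq_minl ?geq_minr //.
    by apply: leq_trans gt_ja _.
  - have dj : d j = 1 by rewrite e_ja.
    have dj1 : d j.+1 = 0 by rewrite dabove // e_ja.
    move=> h1 h2; rewrite dj dj1 muln0; apply: exchange_top => //; by rewrite e_ja.
(* The vector at D has to remain [C], so only the vector at i moves when i.+1 = D. *)
pose K' l j := if l == i then up j else if (l == i.+1) && (l < D) then dn' j else K l j.
have nei : (i.+1 == i) = false by lia.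
have K'i : K' i = up by rewrite /K' eqxx.
have K'l l : l != i -> l != i.+1 -> K' l = K l by rewrite /K' => /negPf-> /negPf->.
have K'S : K' i.+1 = if i.+1 < D then dn' else K i.+1.
  by rewrite /K' nei eqxx; case: ifP.
exists K'; split.
- split=> [l le_lD|l j lt_lD|j le_jn].
  + have [->|ne] := eqVneq l i.
      rewrite K'i; split; [by rewrite /up k0 d0|by move=> j le_nj; rewrite /up kn // dn|by move=> j /lev[]].
    have [->|ne1] := eqVneq l i.+1; last by rewrite K'l //; apply: ok.
    rewrite K'S; case: ifP => _; last exact: ok.
    split; [by rewrite /dn' l0|by move=> j le_nj; rewrite /dn' ln|by move=> j /lev[]].
  + have := mono l j lt_lD; have dj := d2 j.
    have [->|ne] := eqVneq l i.
      by rewrite K'i K'S /up /dn' Ec; case: ifP => _ _; rewrite ?Ec; lia.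
    have [e1|ne1] := eqVneq l.+1 i.
      rewrite K'l ?e1; [|lia|lia]; rewrite K'i /up; lia.
    have [e|ne2] := eqVneq l i.+1.
      rewrite e in lt_lD *; rewrite K'S lt_lD K'l; [|lia|lia]; rewrite /dn'; lia.
    by rewrite !K'l //; lia.
  + have [e|ne1] := eqVneq D i.+1; last by rewrite K'l ?eC //; lia.
    by rewrite {1}e K'S -e ltnn eC.
- have key : levval i (K i) + levval i.+1 (K i.+1) <= levval i up + levval i.+1 dn'.
    by apply: levval_exch => j /lev[].
  have := @sum_replace2 D.+1 i (fun l => levval l (K l)) (fun l => levval l (K' l)) lt_iD.
  rewrite -/(total K) -/(total K') K'i K'S => /(_ (fun l ne ne1 => congr1 _ (esym (K'l l ne ne1)))).
  suff: levval i (K i) + levval i.+1 (K i.+1)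
     <= levval i up + levval i.+1 (if i.+1 < D then dn' else K i.+1) by lia.
  (* Level D takes every token, so keeping [C] there is at least as good as the lowered vector. *)
  case: ltnP => // ge_D; apply: leq_trans key _; rewrite leq_add2l.
  have e_D : i.+1 = D by lia.
  apply: leq_sum => j _; have lt_jn := ltn_ord j.
  have eA : level i.+1 (K i.+1) j = tail j 0.
    rewrite /level e_D !eC ?(ltnW lt_jn) //; move: (tail_C lt_jn).
    by move: (r j + D * p.-1) (p * _) => *; lia.
  have [lt_ja|ge_ja] := ltnP j a.
    apply: topval_le; rewrite /level /dn' mulnBr.
    have le1 : d j <= p * d j.+1 by rewrite dbelow // leq_subr.
    have := lle _ lt_jn; have := d2 j; rewrite Ec.
    have: p * d j.+1 <= p * K i.+1 j.+1.
      by rewrite leq_mul2l Ec; apply/orP; right; have := d2 j.+1; lia.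
    move: (r j + i.+1 * p.-1) (p * _) (p * _) le1 => *; lia.
  rewrite eA; apply: leq_trans (@topval_small j 0 _ _ (leqnn _)) _.
  by rewrite /lowval big_ord0 addn0.
- pose q (k : nat -> nat) := \sum_(j < n.+1) (C j - k j) ^ 2.
  have := @sum_replace2 D.+1 i (fun l => q (K l)) (fun l => q (K' l)) lt_iD.
  rewrite -/(spread K) -/(spread K') K'i K'S => /(_ (fun l ne ne1 => congr1 _ (esym (K'l l ne ne1)))).
  suff: q up + q (if i.+1 < D then dn' else K i.+1) + \sum_(j < n.+1) 2 * (d j * d j)
     <= q (K i) + q (K i.+1).
    have: 0 < \sum_(j < n.+1) 2 * (d j * d j).
      by rewrite (bigD1 (Ordinal (ltnW lt_an : a < n.+1))) //= da.
    by lia.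
  rewrite /q -!big_split /=; apply: leq_sum => j _.
  have leC : K i.+1 j <= C j by apply: feasible_leC => //; rewrite -ltnS.
  have := d2 j; have := Ec j; rewrite /up /dn' -!mulnn; case: ifP => _ E2 dj.
    (* Two distances to [C] that differ by at least 2d lose at least 2d^2 in their sum of squares
       when each moves by d towards the other. *)
    have -> : C j - K i j = C j - K i.+1 j + 2 * d j + (c j - 2 * d j) by lia.
    have -> : C j - (K i j + d j) = C j - K i.+1 j + d j + (c j - 2 * d j) by lia.
    have -> : C j - (K i.+1 j - d j) = C j - K i.+1 j + d j by lia.
    by nia.
  have -> : C j - K i j = C j - K i.+1 j + 2 * d j + (c j - 2 * d j) by lia.
  have -> : C j - (K i j + d j) = C j - K i.+1 j + d j + (c j - 2 * d j) by lia.
  by nia.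
Qed.

Lemma flatten K : feasible K -> exists K', [/\ feasible K', flat K' & total K <= total K'].
Proof.
have [m] := ubnP (spread K); elim: m K => // m IHm K lt_m fK.
have [/existsP[i /existsP[a drop]]|] := boolP [exists i : 'I_D, exists a : 'I_n,
   level i.+1 (K i.+1) a < level i (K i) a].
  have [K' [fK' le_t lt_s]] := flatten_step fK (ltn_ord i) (ltn_ord a) drop.
  have [|K2 [fK2 flK2 le2]] := IHm K' _ fK'; first by lia.
  by exists K2; split=> //; apply: leq_trans le2.
rewrite negb_exists => /forallP H; exists K; split=> // i a lt_i lt_a.
have := H (Ordinal lt_i); rewrite negb_exists => /forallP/(_ (Ordinal lt_a)).
by rewrite -leqNgt.
Qed.

(** * Lattice operations and supermodularity *)

Definition meet (K L : nat -> nat -> nat) i j := minn (K i j) (L i j).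
Definition join (K L : nat -> nat -> nat) i j := maxn (K i j) (L i j).

Lemma level_lattice i k l j : okvec i k -> okvec i l -> j < n ->
  let m j := minn (k j) (l j) in let M j := maxn (k j) (l j) in
  [/\ m j <= r j + i * p.-1 + p * m j.+1, M j <= r j + i * p.-1 + p * M j.+1 &
  [/\ level i k j + level i l j = level i m j + level i M j,
     minn (level i k j) (level i l j) <= level i m j
   & minn (level i k j) (level i l j) <= level i M j]].
Proof.
move=> [_ _ okk] [_ _ okl] lt_jn m M.
rewrite /level /m /M minnMr maxnMr.
exact: exchange_lattice (okk j lt_jn) (okl j lt_jn).
Qed.

Lemma okvec_lattice i k l : okvec i k -> okvec i l ->
  okvec i (fun j => minn (k j) (l j)) /\ okvec i (fun j => maxn (k j) (l j)).
Proof.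
move=> okk okl; have [k0 kn _] := okk; have [l0 ln _] := okl.
split; split; rewrite ?k0 ?l0 // => j; try by [move/(level_lattice okk okl)=> []];
  by move=> le_nj; rewrite kn ?ln.
Qed.

(** In each type the meet and the join preserve the sum of the two levels and do not lower the
    smaller one, so concavity applies. *)
Lemma levval_lattice i k l : okvec i k -> okvec i l ->
  levval i k + levval i l <=
  levval i (fun j => minn (k j) (l j)) + levval i (fun j => maxn (k j) (l j)).
Proof. by move=> okk okl; apply: levval_exch => j /(level_lattice okk okl)[]. Qed.

Lemma feasible_lattice K L : feasible K -> feasible L ->
  feasible (meet K L) /\ feasible (join K L).
Proof.
move=> [okK mK eK] [okL mL eL]; split; split.
- by move=> i le_iD; have [] := okvec_lattice (okK i le_iD) (okL i le_iD).
- by move=> i j lt_iD; have := mK i j lt_iD; have := mL i j lt_iD; rewrite /meet; lia.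
- by move=> j le_jn; rewrite /meet eK ?eL ?minnn.
- by move=> i le_iD; have [] := okvec_lattice (okK i le_iD) (okL i le_iD).
- by move=> i j lt_iD; have := mK i j lt_iD; have := mL i j lt_iD; rewrite /join; lia.
- by move=> j le_jn; rewrite /join eK ?eL ?maxnn.
Qed.

Lemma total_lattice K L : feasible K -> feasible L ->
  total K + total L <= total (meet K L) + total (join K L).
Proof.
move=> [okK _ _] [okL _ _]; rewrite /total -!big_split; apply: leq_sum => i _ /=.
by apply: levval_lattice; [apply: okK|apply: okL]; rewrite -ltnS.
Qed.

(* One token of type [a] is traded for tokens of smaller types and the same total cost. *)
Definition is_move a (d : nat -> nat) :=
  [/\ d a = 1, forall j, a < j -> d j = 0, d 0 = 0 & forall j, j < a -> d j <= p * d j.+1].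

Definition shift (k d : nat -> nat) j := k j + d j.
Definition excess (d : nat -> nat) j := p * d j.+1 - d j.
(** Here [d j] counts the tokens of type j broken into p of the type below, and [excess d j] those
    kept. [undo l d] breaks one token of type l less; the missing pieces are taken from the kept
    tokens first, then from further breaks. *)
Definition undo l (d : nat -> nat) j := d j - chain p l (excess d) j.

Lemma undo_move a l d : is_move a d -> l < a -> 0 < d l -> is_move a (undo l d).
Proof.
move=> [da dabove d0 dbelow] lt_la dl.
split=> [|j lt_aj||j lt_ja]; rewrite /undo.
- by rewrite chain_above // da.
- by rewrite dabove.
- by rewrite d0.
have [lt_lj|gt_lj|e_lj] := ltngtP l j.
- by rewrite !chain_above ?(leqW lt_lj) // !subn0 dbelow.
- have := chain_le p j.+1 dl; have := chain_below p (excess d) gt_lj.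
  rewrite /excess mulnBr -[chain _ _ _ j.+1 <= _](leq_pmul2l p_gt0).
  have := dbelow j lt_ja; move: (p * _) (p * _) (d j) (chain _ _ _ j) => *; lia.
- rewrite -e_lj [chain _ _ _ l.+1]chain_above // subn0.
  by apply: leq_trans (leq_subr _ _) _; apply: dbelow.
Qed.

(** Breaks are undone as long as the value strictly grows; each time the number of breaks drops. *)
Lemma best_move i k a d : is_move a d -> exists e,
  [/\ is_move a e, forall j, e j <= d j, levval i (shift k d) <= levval i (shift k e)
    & forall l, l < a -> 0 < e l ->
        levval i (shift k (undo l e)) <= levval i (shift k e)].
Proof.
have [m] := ubnP (\sum_(j < a.+1) d j); elim: m d => // m IHm d lt_m md.
have [/existsP[l /andP[dl better]]|] := boolP [exists l : 'I_a, (0 < d l) &&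
    (levval i (shift k d) < levval i (shift k (undo l d)))].
  have [||e [me le_e val_e best_e]] := IHm (undo l d).
  - suff: \sum_(j < a.+1) undo l d j < \sum_(j < a.+1) d j by lia.
    have lt_la : l < a.+1 by rewrite ltnW // ltnS.
    rewrite [X in _ < X](bigD1 (Ordinal lt_la)) // [X in X < _](bigD1 (Ordinal lt_la)) //=.
    have lt_u : undo l d l < d l by rewrite /undo chain_top; lia.
    by rewrite -addSn; apply: (leq_add lt_u); apply: leq_sum => j _; rewrite leq_subr.
  - exact: undo_move.
  exists e; split=> // [j|]; first by apply: leq_trans (le_e j) (leq_subr _ _).
  by apply: leq_trans val_e; apply: ltnW.
rewrite negb_exists => /forallP none; exists d; split=> // l lt_la dl.
by have := none (Ordinal lt_la); rewrite /= dl /= -leqNgt.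
Qed.

Lemma level_shift i k a d j : is_move a d -> okvec i k -> a < n -> 0 < level i k a ->
  j < n -> shift k d j <= r j + i * p.-1 + p * shift k d j.+1 /\
  level i (shift k d) j =
    if j < a then level i k j + excess d j else if j == a then (level i k j).-1
    else level i k j.
Proof.
move=> [da dabove d0 dbelow] [_ _ okk] lt_an; rewrite /level /shift /excess mulnDr.
have [lt_ja|gt_ja|->] := ltngtP j a.
- move=> _ lt_jn; have := okk j lt_jn; have := dbelow j lt_ja.
  move: (r j + _) (p * _) (p * _) => *; lia.
- move=> _ lt_jn; rewrite dabove // dabove ?muln0 ?addn0; last exact: ltnW.
  by split=> //; apply: okk.
- move=> lv lt_jn; rewrite da dabove // muln0 addn0.
  move: lv; move: (r a + _) (p * _) => *; lia.
Qed.

Lemma okvec_shift i k a d : is_move a d -> okvec i k -> a < n -> 0 < level i k a ->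
  okvec i (shift k d).
Proof.
move=> md okk lt_an lv; have [k0 kn _] := okk; have [_ dabove d0 _] := md.
split; rewrite /shift ?k0 ?d0 // => j lt_jn.
  by rewrite kn // dabove // (leq_trans lt_an).
by have [] := level_shift md okk lt_an lv lt_jn.
Qed.

Let lowsum z := \sum_(j < n) lowval j z.

(** The terms decrease geometrically by steps of p^n; n > 1 leaves a factor p between p^(x - n) and
    p^(x - 1). *)
Lemma lowsum_series x m : 1 < n -> 0 < x -> \sum_(s < m) lowsum (x - n * s.+1) < p ^ x.-1.
Proof.
move=> n1; have [k] := ubnP x; elim: k x m => // k IHk x [|m] lt_xk x0.
  by rewrite big_ord0 expn_gt0 p_gt0.
have low0 : lowsum 0 = 0 by apply: big1 => j _; rewrite /lowval big_ord0.
have [le_xn|lt_nx] := leqP x n.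
  rewrite big1 ?expn_gt0 ?p_gt0 // => s _.
  by have -> : x - n * s.+1 = 0 by lia.
rewrite big_ord_recl muln1; have low := lowval_sum (x - n).
have := IHk (x - n) m; rewrite (eq_bigr (fun s : 'I_m => lowsum (x - n * (lift ord0 s).+1))).
  move=> /(_ _ _) H; have {H}H : \sum_(s < m) lowsum (x - n * (lift ord0 s).+1) < p ^ (x - n).-1.
    by apply: H; lia.
  have e1 : p ^ (x - n).-1 <= p ^ (x - n) by rewrite leq_exp2l // leq_pred.
  have e2 : p * p ^ (x - n) <= p ^ x.-1 by rewrite -expnS leq_exp2l //; lia.
  have e3 : 2 * p ^ (x - n) <= p * p ^ (x - n) by rewrite leq_mul2r p_gt1 orbT.
  rewrite -/(lowsum (x - n)) in low; move: (lowsum _) (p ^ _) (p ^ _) (p ^ _) low H e1 e2 e3 => *; lia.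
by move=> s _; congr lowsum; rewrite /= /bump /=; lia.
Qed.

(** * A trade performed at all later levels *)

Section Improve.
Variables (K : nat -> nat -> nat) (i a : nat) (e : nat -> nat).
Hypotheses (fK : feasible K) (le_iD : i <= D) (lt_an : a < n) (me : is_move a e).
Hypothesis e_best : forall l, l < a -> 0 < e l ->
  levval i (shift (K i) (undo l e)) <= levval i (shift (K i) e).
Hypotheses (lv_gt0 : 0 < level i (K i) a) (lv_le : level i (K i) a <= tail a 0).
Hypothesis gain : levval i (K i) <= levval i (shift (K i) e).

Let k := K i.
Let L := shift k e.
Let okk : okvec i k. Proof. by have [ok _ _] := fK; apply: ok. Qed.
Let okL : okvec i L. Proof. exact: okvec_shift me okk lt_an lv_gt0. Qed.

Let level_L j : j < n -> level i L j =
    if j < a then level i k j + excess e j else if j == a then (level i k j).-1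
    else level i k j.
Proof. by move=> lt_jn; have [] := level_shift me okk lt_an lv_gt0 lt_jn. Qed.

Let sum_pick m (w : nat) : m < n -> \sum_(j < n) (j == m :> nat) * w = w.
Proof.
move=> lt_mn; rewrite (bigD1 (Ordinal lt_mn)) //= eqxx mul1n big1 ?addn0 // => j ne.
by rewrite -val_eqE in ne; rewrite (negPf ne).
Qed.

(* [x] is the highest position gained by the move and [b] the position lost. If a token of
   a type broken by the move were still available at [x] or above, undoing the break would
   be better, against [e_best]. *)
Lemma move_positions : exists b x, [/\ b < x,
  levval i k + p ^ x <= levval i L + p ^ b
  & forall j, j < n -> 0 < e j -> tail j x <= level i L j].
Proof.
have [ea eabove e0 ebelow] := me.
have lv_pred : (level i k a).-1 < tail a 0 by rewrite prednK.
have [b [b_mod b_le b_lt]] := token_pos lv_pred.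
(* Otherwise all gained tokens lie below b and are together worth less than the token lost at b,
   against [gain]. *)
have [j0 [lt_j0a ex_j0 lt_j0]] : exists j, [/\ j < a, 0 < excess e j & level i k j < tail j b].
  have [/existsP[j /andP[h1 h2]]|] := boolP [exists j : 'I_a, (0 < excess e j) && (level i k j < tail j b)].
    by exists j.
  rewrite negb_exists => /forallP none; exfalso.
  have: levval i L + p ^ b <= levval i k + lowsum b.
    rewrite -(sum_pick (p ^ b) lt_an) /levval /lowsum -!big_split; apply: leq_sum => j _ /=.
    rewrite level_L //; have [lt_ja|gt_ja|->] := ltngtP (val j) a; rewrite ?mul0n ?addn0 ?leq_addr ?mul1n //.
      have := none (Ordinal lt_ja); rewrite negb_and -!leqNgt /= leqn0.
      case/orP => [/eqP->|le_t]; first by rewrite addn0 leq_addr.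
      exact: topval_small.
    apply: leq_trans (leq_addr _ _); have := topval_gain b_lt; by rewrite prednK.
  have := lowval_sum b; rewrite -/(lowsum b); move: gain; rewrite -/k -/L.
  by move: (p ^ b) => *; lia.
(* The maximal x is the highest position where a type gained by the trade still has a token
   available. *)
pose P x := [exists j : 'I_a, (0 < excess e j) && (level i k j < tail j x)].
have exP : exists x, P x by exists b; apply/existsP; exists (Ordinal lt_j0a); rewrite /= ex_j0.
have bndP x : P x -> x <= B.
  move=> /existsP[j /andP[_]]; apply: contraTT; rewrite -ltnNge => lt_Bx.
  by rewrite tail_ge // ltnW.
have [x /existsP[[m lt_ma] /= /andP[ex_m lt_m]] max_x] := ex_maxnP exP bndP.
have le_bx : b <= x by apply: max_x; apply/existsP; exists (Ordinal lt_j0a); rewrite /= ex_j0.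
have maxP j : j < a -> 0 < excess e j -> tail j x.+1 <= level i k j.
  move=> lt_ja ex_j; rewrite leqNgt; apply/negP => lt_j.
  have: x.+1 <= x by apply: max_x; apply/existsP; exists (Ordinal lt_ja); rewrite /= ex_j.
  by rewrite ltnn.
have x_mod : x %% n = m.
  by apply/eqP; apply: contraT => /tail_off e_t; have := maxP m lt_ma ex_m; lia.
have lt_bx : b < x by rewrite ltn_neqAle le_bx andbT; apply/eqP => e_bx; move: x_mod; rewrite -e_bx b_mod; lia.
exists b, x; split=> //.
  have lt_mn : m < n by apply: ltn_trans lt_an.
  rewrite -(sum_pick (p ^ x) lt_mn) -(sum_pick (p ^ b) lt_an) /levval -!big_split.
  apply: leq_sum => j _ /=; rewrite level_L //.
  have [lt_ja|gt_ja|e_ja] := ltngtP (val j) a.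
  - rewrite addn0; have [e_jm|_] := eqVneq (val j) m; last by rewrite addn0 topval_le // leq_addr.
    rewrite mul1n e_jm; apply: leq_trans (topval_gain lt_m) _; apply: topval_le.
    by rewrite -addn1 leq_add2l.
  - by have -> : (val j == m) = false by lia.
  - have -> : (val j == m) = false by lia.
    rewrite addn0 mul1n e_ja; have := topval_step b_le; by rewrite prednK.
move=> l lt_ln el; rewrite level_L //.
have [lt_la|gt_la|->] := ltngtP l a; last first.
- by apply: leq_trans b_le; apply: tail_le.
- by move: el; rewrite eabove.
rewrite leqNgt; apply/negP => lt_l.
(* Position x has type m. Hence for l other than m nothing changes between x and x.+1, while for l =
   m the smaller gained types have no token available at x. *)
pose z := if l == m then x else x.+1.
have lt_z : level i k l + excess e l < tail l z.
  rewrite /z; case: eqP => [//|/eqP ne]; by rewrite tail_off // x_mod eq_sym.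
have le_z j : j < l -> 0 < excess e j -> tail j z <= level i k j.
  move=> lt_jl ex_j; have := maxP j (ltn_trans lt_jl lt_la) ex_j; rewrite /z.
  by case: eqP => // e_lm; rewrite tail_off // x_mod; lia.
have mu := undo_move me lt_la el.
have lvu j : j < n -> level i (shift k (undo l e)) j =
    if j < a then level i k j + excess (undo l e) j else if j == a then (level i k j).-1
    else level i k j.
  by move=> lt_jn; have [] := level_shift mu okk lt_an lv_gt0 lt_jn.
have xu j : l < j -> excess (undo l e) j = excess e j.
  by move=> lt_lj; rewrite /excess /undo !chain_above ?subn0 // leqW.
have xul : excess (undo l e) l = (excess e l).+1.
  rewrite /excess /undo chain_top [chain _ _ _ l.+1]chain_above // subn0.
  by have := ebelow l lt_la; move: el (p * _); clear => *; lia.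
have xud j : j < l -> excess (undo l e) j <= excess e j.
  move=> lt_jl; rewrite /excess /undo mulnBr.
  have := chain_below p (excess e) lt_jl; rewrite {2}/excess.
  have := chain_le p j el; rewrite -/(excess e).
  by move: (p * _) (p * _) (chain _ _ _ _); clear => *; lia.
(* Undoing the break at l regains a token at z or above and gives up only tokens below z. *)
have: levval i L + p ^ z <= levval i (shift k (undo l e)) + lowsum z.
  rewrite -(sum_pick (p ^ z) lt_ln) /levval /lowsum -!big_split; apply: leq_sum => j _ /=.
  rewrite level_L // lvu //; case: (ltnP j a) => [lt_ja|ge_ja]; last first.
    by rewrite (gtn_eqF (leq_trans lt_la ge_ja)) addn0 leq_addr.
  have [lt_jl|gt_jl|->] := ltngtP (val j) l.
  - rewrite addn0; have := xud j lt_jl; rewrite leq_eqVlt => /orP[/eqP->|lt_ex].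
      exact: leq_addr.
    apply: topval_small; apply: leq_trans (leq_addr _ _); apply: le_z => //.
    exact: leq_ltn_trans lt_ex.
  - by rewrite xu // addn0 leq_addr.
  - by rewrite mul1n xul addnS; apply: leq_trans (leq_addr _ _); apply: topval_gain.
have := e_best lt_la el; have := lowval_sum z; rewrite -/(lowsum z) -/k -/L.
by move: (p ^ z) => *; lia.
Qed.

(* The losses at the levels [i + s] are below [p ^ (x - n * s)], the gain at level [i] is
   at least [p ^ x - p ^ x.-1]. *)
Lemma move_improves : (forall j, j <= n -> K i j + e j <= C j) ->
  exists K', feasible K' /\ total K < total K'.
Proof.
move=> leC; have [ea eabove e0 ebelow] := me; have [ok mono eC] := fK.
have [b [x [lt_bx gain_x tail_x]]] := move_positions.
have a_gt0 : 0 < a by rewrite lt0n; apply/eqP => a0; move: ea; rewrite a0 e0.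
have okLl l : i <= l -> okvec l L.
  move=> le_il; have [L0 Ln leL] := okL; split=> // j /leL H.
  by apply: leq_trans H _; rewrite leq_add2r leq_add2l leq_mul2r le_il orbT.
have level_Ll l j : i <= l -> j < n -> level l L j = level i L j + p.-1 * (l - i).
  move=> le_il lt_jn; have [_ _ /(_ j lt_jn)] := okL; rewrite /level.
  have -> : l * p.-1 = i * p.-1 + p.-1 * (l - i) by rewrite [p.-1 * _]mulnC -mulnDl subnKC.
  by move: (i * _) (p * _) (p.-1 * _); clear => *; lia.
(* Taking the maximum with [L] at all later levels keeps the family nondecreasing. *)
pose K' l j := if i <= l then maxn (K l j) (L j) else K l j.
have fK' : feasible K'.
  split=> [l le_lD|l j lt_lD|j le_jn]; rewrite /K'.
  - case: leqP => [le_il|_]; last exact: ok.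
    by have [] := okvec_lattice (ok l le_lD) (okLl l le_il).
  - have := mono l j lt_lD; case: (leqP i l) => [le_il|lt_li].
      by rewrite leqW //; lia.
    by case: ifP => // _; lia.
  - by rewrite le_iD eC //; apply/maxn_idPl; apply: leC.
exists K'; split=> //.
have step l : l <= D -> levval l (K l) + (l == i) * p ^ x <=
    levval l (K' l) + (l == i) * p ^ b + (i < l) * lowsum (x - n * (l - i)).
  move=> le_lD; have [lt_li|gt_li|->] := ltngtP l i.
  - by rewrite /K' (leqNgt i l) lt_li !addn0.
  - rewrite !addn0 mul1n /K' (ltnW gt_li).
    have := levval_lattice (ok l le_lD) (okLl l (ltnW gt_li)).
    suff: levval l (fun j => minn (K l j) (L j)) <= levval l L + lowsum (x - n * (l - i)) by lia.
    rewrite /levval /lowsum -big_split; apply: leq_sum => j _ /=.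
    have lt_jn := ltn_ord j; have [le_L|lt_L] := leqP (L j) (K l j).
      apply: leq_trans (leq_addr _ _); apply: topval_le; rewrite /level (minn_idPr le_L).
      by rewrite leq_sub2r // leq_add2l leq_mul2l geq_minr orbT.
    (* The trade touches type j, so [L] exhausts it down to x at level i; each further level adds p
       - 1 tokens, enough for n more positions. *)
    apply: topval_small; rewrite level_Ll ?(ltnW gt_li) //.
    apply: leq_trans (tail_window _ _ _) _; rewrite leq_add2r; apply: tail_x => //.
    have := feasible_le j fK (ltnW gt_li) le_lD; move: lt_L; rewrite /L /shift /k; lia.
  - rewrite addn0 !mul1n; have -> : levval i (K' i) = levval i L; last exact: gain_x.
    apply: eq_bigr => j _; congr topval; rewrite /level /K' leqnn.
    by rewrite !(maxn_idPr _) // /L /shift leq_addr.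
have {step} := leq_sum (index_enum 'I_D.+1) (P := predT) (fun l _ => step (val l) (ltn_ord l)).
rewrite !big_split /= -/(total K) -/(total K').
have pick w : \sum_(l < D.+1) (l == i :> nat) * w = w.
  rewrite (bigD1 (Ordinal (le_iD : i < D.+1))) //= eqxx mul1n big1 ?addn0 // => l ne.
  by rewrite -val_eqE in ne; rewrite (negPf ne).
rewrite !pick.
have -> : \sum_(l < D.+1) (i < l) * lowsum (x - n * (l - i))
        = \sum_(s < D - i) lowsum (x - n * s.+1).
  rewrite -(big_mkord predT (fun l => (i < l) * lowsum (x - n * (l - i)))).
  rewrite (big_cat_nat (n := i.+1)) ?ltnS //= big_nat_cond big1 ?add0n; last first.
    by move=> l; rewrite andbT ltnS => /andP[_ le_li]; rewrite ltnNge le_li.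
  rewrite -{1}[i.+1]add0n big_addn subSS big_mkord; apply: eq_bigr => s _.
  by rewrite leq_addl mul1n; congr lowsum; lia.
(* As 0 < a < n, there are at least two types. *)
have := @lowsum_series x (D - i); rewrite (leq_ltn_trans _ lt_bx) //.
move=> /(_ (leq_ltn_trans a_gt0 lt_an) isT).
(* The net gain p^x - p^b is at least p^(x - 1), hence above the sum of the losses. *)
have e1 : p ^ b <= p ^ x.-1 by rewrite leq_exp2l //; lia.
have e2 : 2 * p ^ x.-1 <= p ^ x.
  by rewrite -{2}(ltn_predK lt_bx) expnS leq_mul2r p_gt1 orbT.
by move: (p ^ _) (p ^ _) (p ^ _) (\sum_(_ < _) _) e1 e2 => *; lia.
Qed.

End Improve.

Lemma flat_level_le K i j : feasible K -> flat K -> i <= D -> j < n ->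
  level i (K i) j <= tail j 0.
Proof.
move=> [_ _ eC] flK le_iD lt_jn; move: (D - i) (subnKC le_iD) => d {le_iD}.
elim: d i => [|d IHd] i e_D; last first.
  by apply: leq_trans (flK i j _ lt_jn) (IHd i.+1 _); lia.
have -> : i = D by lia.
rewrite /level !eC ?(ltnW lt_jn) //; have := tail_C lt_jn.
by move: (r j + _) (p * _) (tail j 0); clear => *; lia.
Qed.

(** Meet and join of two optima are again optimal. At the first level where these differ, a trade
    from the meet towards the join would improve the meet. Flatness bounds the level of the traded
    type by the tokens available. *)
Lemma optimum_unique K K2 M : (forall K', feasible K' -> total K' <= M) ->
  feasible K -> flat K -> total K = M -> feasible K2 -> flat K2 -> total K2 = M ->
  forall i j, i <= D -> j <= n -> K i j = K2 i j.
Proof.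
move=> maxM fK flK tK fK2 flK2 tK2 i0 j0 le_i0 le_j0; apply/eqP; apply: contraT => ne0.
have [fm fj] := feasible_lattice fK fK2.
set m := meet K K2 in fm *; set J := join K K2 in fj *.
have mE i j : m i j = minn (K i j) (K2 i j) by [].
have JE i j : J i j = maxn (K i j) (K2 i j) by [].
have le_mJ i j : m i j <= J i j by rewrite mE JE; lia.
have [tm tJ] : total m = M /\ total J = M.
  by have := total_lattice fK fK2; have := maxM _ fm; have := maxM _ fj; rewrite -/m -/J; lia.
pose P i := [exists j : 'I_n.+1, m i j < J i j].
have exP : exists i, P i.
  exists i0; apply/existsP; exists (Ordinal (le_j0 : j0 < n.+1)); rewrite mE JE /=; lia.
have [i Pi min_i] := ex_minnP exP.
have le_iD : i <= D.
  apply: leq_trans le_i0; apply: min_i; apply/existsP.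
  by exists (Ordinal (le_j0 : j0 < n.+1)); rewrite mE JE /=; lia.
pose Q j := (j <= n) && (m i j < J i j).
have exQ : exists j, Q j.
  by have /existsP[j lt_j] := Pi; exists j; rewrite /Q lt_j -ltnS ltn_ord.
have bQ j : Q j -> j <= n by case/andP.
have [a /andP[le_an lt_a] max_a] := ex_maxnP exQ bQ.
have [okm mm eCm] := fm; have [okJ mJ eCJ] := fj.
have [m0 mn lem] := okm i le_iD; have [J0 Jn leJ] := okJ i le_iD.
have lt_an : a < n.
  by rewrite ltn_neqAle le_an andbT; apply/eqP => e_an; move: lt_a; rewrite e_an mn // Jn.
have lt_iD : i < D.
  rewrite ltn_neqAle le_iD andbT; apply/eqP => e_iD.
  by move: lt_a; rewrite e_iD eCm // eCJ // ltnn.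
pose dl j := J i j - m i j.
have EJ j : J i j = m i j + dl j by rewrite /dl subnKC.
have dl_a : 0 < dl a by rewrite subn_gt0.
have dl_above j : a < j -> j <= n -> dl j = 0.
  move=> lt_aj le_jn; apply/eqP; rewrite -leqn0 leqNgt; apply/negP => dlj.
  by have := max_a j; rewrite /Q le_jn -subn_gt0 dlj => /(_ isT); lia.
(* A chain inside the difference, so that the shifted meet stays below the join. *)
pose d := chain p a (excess dl).
have d_le j : d j <= dl j by apply: chain_le.
have d_a : d a = 1 by apply: chain_top.
have d_above j : a < j -> d j = 0 by apply: chain_above.
have d_below j : j < a -> d j = p * d j.+1 - excess dl j by apply: chain_below.
have d_0 : d 0 = 0 by have := d_le 0; rewrite /dl J0 m0; lia.
have md : is_move a d by split=> // j lt_ja; rewrite d_below // leq_subr.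
pose up j := m i j + d j; pose dn j := J i j - d j.
have lev j : j < n -> [/\ up j <= r j + i * p.-1 + p * up j.+1,
    dn j <= r j + i * p.-1 + p * dn j.+1 &
    [/\ level i (m i) j + level i (J i) j = level i up j + level i dn j,
     minn (level i (m i) j) (level i (J i) j) <= level i up j
   & minn (level i (m i) j) (level i (J i) j) <= level i dn j]].
  move=> lt_jn; have := lem j lt_jn; have := leJ j lt_jn.
  rewrite /level /up /dn !EJ mulnBr !mulnDr.
  have [lt_ja|gt_ja|e_ja] := ltngtP j a.
  - move=> h1 h2; apply: (@exchange_below _ 0) => //; last by rewrite d_below.
    by rewrite leq_pmul2l.
  - rewrite !d_above ?(leqW gt_ja) // !muln0 !addn0 !subn0.
    by split=> //; split=> //; rewrite ?geq_minl ?geq_minr.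
  - have dj : d j = 1 by rewrite e_ja.
    have dj1 : d j.+1 = 0 by rewrite d_above // e_ja.
    have dlj1 : dl j.+1 = 0 by rewrite dl_above // e_ja.
    move=> h1 h2; rewrite dj dj1 muln0; apply: (@exchange_top _ 0) => //.
    by rewrite dlj1 muln0 addn0 e_ja.
(* Lowering the optimal join by [d] at level i gains nothing; by the exchange inequality, raising
   the meet by [d] then loses nothing. *)
have gain : levval i (m i) <= levval i up.
  have key : levval i (m i) + levval i (J i) <= levval i up + levval i dn.
    by apply: levval_exch => j /lev[].
  pose J' l j := if l == i then dn j else J l j.
  have fJ' : feasible J'.
    split=> [l le_lD|l j lt_lD|j le_jn]; rewrite /J'.
    - case: eqP => [->|_]; last exact: okJ.
      by split; rewrite /dn ?J0 // => j; [move=> le_nj; rewrite Jn|move/lev=> []].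
    - case: eqP => [e_l|ne_l].
        have -> : (l.+1 == i) = false by lia.
        by apply: leq_trans (mJ l j lt_lD); rewrite /dn e_l leq_subr.
      case: eqP => [e_l|_]; last exact: mJ.
      (* By minimality of i, meet and join agree at all earlier levels. *)
      have -> : J l j = m l j.
        have [lt_mJ|] := ltnP (m l j) (J l j); last by have := le_mJ l j; lia.
        have [le_jn|lt_nj] := leqP j n.
          have: P l by apply/existsP; exists (Ordinal (le_jn : j < n.+1)).
          by move/min_i; lia.
        have [_ z1 _] := okm l (ltnW lt_lD); have [_ z2 _] := okJ l (ltnW lt_lD).
        by rewrite z1 ?z2 // ltnW.
      apply: leq_trans (mm l j lt_lD) _; rewrite e_l /dn EJ; have := d_le j; lia.
    - by rewrite (gtn_eqF lt_iD) eCJ.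
  have := maxM _ fJ'; rewrite -tJ /total.
  have lt_iD1 : i < D.+1 by [].
  rewrite (bigD1 (Ordinal lt_iD1)) //= [X in _ <= X](bigD1 (Ordinal lt_iD1)) //=.
  have -> : J' i = dn by rewrite /J' eqxx.
  rewrite (eq_bigr (fun l : 'I_D.+1 => levval l (J l))) ?leq_add2r; first by lia.
  by move=> l; rewrite -val_eqE /J' /= => /negPf->.
have lv_a : 0 < level i (m i) a.
  have := leJ a lt_an; have dl1 : dl a.+1 = 0 by rewrite dl_above.
  rewrite /level !EJ dl1 addn0; move: dl_a.
  by move: (r a + _) (p * _) (dl a); clear => *; lia.
have [e [me le_e val_e best_e]] := best_move i (m i) md.
have lv_le : level i (m i) a <= tail a 0.
  have [ok1 _ _] := fK; have [ok2 _ _] := fK2.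
  have [_ _ []] := level_lattice (ok1 i le_iD) (ok2 i le_iD) lt_an.
  have := flat_level_le fK flK le_iD lt_an; have := flat_level_le fK2 flK2 le_iD lt_an.
  by rewrite -/(m i); move: (level i _ _) (level i _ _) (level i _ _) (level i _ _) (tail a 0); clear => *; lia.
have [||K' [fK' lt_K']] := move_improves fm le_iD lt_an me best_e lv_a lv_le.
- exact: leq_trans val_e.
- move=> j le_jn; apply: leq_trans (feasible_leC fj le_iD le_jn).
  by rewrite EJ leq_add2l; apply: leq_trans (le_e j) (d_le j).
by have := maxM _ fK'; lia.
Qed.

(* The smallest carries keeping each level below the number of available tokens. *)
Fixpoint fill_up i t :=
  if t is t'.+1 then r (n - t) + i * p.-1 + p * fill_up i t' - tail (n - t) 0 else 0.

Lemma fill_upC i t : i <= D -> t <= n -> fill_up i t <= C (n - t) /\ fill_up D t = C (n - t).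
Proof.
move=> le_iD; elim: t => [|t IHt] le_tn /=; first by rewrite subn0 C_n.
have [IH1 IH2] := IHt (ltnW le_tn).
have lt_n : n - t.+1 < n by lia.
have := tail_C lt_n; have -> : (n - t.+1).+1 = n - t by lia.
have: p * fill_up i t <= p * C (n - t) by rewrite leq_mul2l IH1 orbT.
have: i * p.-1 <= D * p.-1 by rewrite leq_mul2r le_iD orbT.
rewrite IH2; move: (tail _ _) (r _) (C (n - t.+1)) (p * fill_up i t) (p * C _) (i * _) (D * _).
by clear => *; lia.
Qed.

(** With greedy carries each level is the minimum of the tokens on offer and the tokens present,
    which is nondecreasing in i. *)
Lemma feasible_exists : exists K, feasible K /\ flat K.
Proof.
pose K i j := if j <= n then fill_up i (n - j) else 0.
have KC i j : i <= D -> j <= n -> K i j <= C j.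
  move=> le_iD le_jn; rewrite /K le_jn; have [H _] := fill_upC le_iD (leq_subr j n).
  by apply: leq_trans H _; rewrite subKn.
have Kstep i j : i <= D -> j < n ->
    K i j <= r j + i * p.-1 + p * K i j.+1 /\
    level i (K i) j = minn (r j + i * p.-1 + p * K i j.+1) (tail j 0).
  move=> le_iD lt_jn; have : K i j = r j + i * p.-1 + p * K i j.+1 - tail j 0.
    rewrite /K lt_jn ltnW //; have -> : n - j = (n - j.+1).+1 by lia.
    by rewrite /=; have -> : n - (n - j.+1).+1 = j by lia.
  rewrite /level => ->; move: (r j + _ + _) (tail j 0); clear => *; lia.
have mono i j : i < D -> K i j <= K i.+1 j.
  rewrite /K; case: ifP => // _ _; elim: (n - j) => //= t IHt.
  have: p * fill_up i t <= p * fill_up i.+1 t by rewrite leq_mul2l IHt orbT.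
  by rewrite mulSn; move: (p * _) (p * _) (i * _) (tail _ _) (r _); clear => *; lia.
exists K; split; first split=> //.
- move=> i le_iD; split.
  + by have := KC i 0 le_iD (leq0n n); rewrite C_0 leqn0 => /eqP.
  + move=> j; rewrite leq_eqVlt /K => /orP[/eqP<-|lt_nj]; first by rewrite leqnn subnn.
    by rewrite leqNgt lt_nj.
  + by move=> j /(Kstep i j le_iD)[].
- move=> j le_jn; rewrite /K le_jn; have [_ ->] := fill_upC (leqnn D) (leq_subr j n).
  by rewrite subKn.
move=> i j lt_iD lt_jn; have [_ ->] := Kstep i j (ltnW lt_iD) lt_jn.
have [_ ->] := Kstep i.+1 j lt_iD lt_jn.
have: p * K i j.+1 <= p * K i.+1 j.+1 by rewrite leq_mul2l mono ?orbT.
by rewrite mulSn; move: (p * _) (p * _) (i * _) (tail _ _) (r _); clear => *; lia.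
Qed.

End Tokens.

(** * Base-p digits and carries *)

(** Written addition in base p: the column sum plus the incoming carry is the digit plus p times the
    outgoing carry. *)
Lemma carry_eq p n (N : nat -> nat) j : 1 < p -> j < n ->
  let g m := \sum_(i < m) p ^ i * N i in
  N j + g j %/ p ^ j = (g n %/ p ^ j) %% p + p * (g j.+1 %/ p ^ j.+1).
Proof.
move=> p1 lt_jn g; have p0 := ltnW p1.
have pX m : 0 < p ^ m by rewrite expn_gt0 p0.
have gS m : g m.+1 = g m + p ^ m * N m by rewrite /g big_ord_recr.
have [h ->] : exists h, g n = g j.+1 + p ^ j.+1 * h.
  move/subnKC: lt_jn => <-; elim: (n - j.+1) => [|d [h IHd]].
    by exists 0; rewrite muln0 !addn0.
  by exists (h + p ^ d * N (j.+1 + d)); rewrite addnS gS IHd mulnDr mulnA -expnD addnA.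
have divj m x : (x + p ^ j * m) %/ p ^ j = x %/ p ^ j + m by rewrite mulnC divnDMl.
rewrite expnS [p * _]mulnC -mulnA divnMA gS !divj [N j + _]addnC [p * h]mulnC.
by rewrite [_ + h * p]addnC modnMDl [RHS]addnC [p * _]mulnC -divn_eq.
Qed.

Lemma digit_pred_exp p n j : 1 < p -> j < n -> ((p ^ n).-1 %/ p ^ j) %% p = p.-1.
Proof.
move=> p1 lt_jn; have p0 := ltnW p1.
have -> : (p ^ n).-1 = (p ^ (n - j)).-1 * p ^ j + (p ^ j).-1.
  have -> : p ^ n = p ^ (n - j) * p ^ j by rewrite -expnD subnK // ltnW.
  have : 0 < p ^ j by rewrite expn_gt0 p0.
  have : 0 < p ^ (n - j) by rewrite expn_gt0 p0.
  by move: (p ^ (n - j)) (p ^ j) => [|u] // [|v] // _ _; rewrite mulSn addSn !succnK addnC.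
have lt_j : (p ^ j).-1 < p ^ j by rewrite prednK // expn_gt0 p0.
rewrite divnMDl ?expn_gt0 ?p0 // divn_small // addn0.
have -> : n - j = (n - j.+1).+1 by lia.
rewrite expnSr; have : 0 < p ^ (n - j.+1) by rewrite expn_gt0 p0.
move: (p ^ _) => [|u] // _; rewrite mulSn.
have -> : (p + u * p).-1 = u * p + p.-1 by lia.
by rewrite modnMDl modn_small // prednK.
Qed.

Lemma sum_digits p n R : 1 < p -> \sum_(j < n) p ^ j * ((R %/ p ^ j) %% p) = R %% p ^ n.
Proof.
move=> p1; elim: n => [|n IHn]; first by rewrite big_ord0 modn1.
rewrite big_ord_recr /= IHn.
have E : R = R %/ p ^ n %/ p * p ^ n.+1 + (R %/ p ^ n %% p * p ^ n + R %% p ^ n).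
  by rewrite expnS mulnA addnA -mulnDl -!divn_eq.
rewrite [in RHS]E modnMDl [RHS]modn_small; first by rewrite addnC mulnC.
rewrite expnS; have: R %/ p ^ n %% p < p by rewrite ltn_mod ltnW.
have: R %% p ^ n < p ^ n by rewrite ltn_mod expn_gt0 ltnW.
move: (p ^ n) (R %% p ^ n) (R %/ p ^ n %% p) => z x y lt_xz lt_y.
have: y.+1 * z <= p * z by rewrite leq_mul2r lt_y orbT.
by rewrite mulSn; lia.
Qed.

Lemma sum_ltn_bool c t N : \sum_(s < c) (t + s < N) = minn c (N - t).
Proof.
elim: c => [|c IHc]; first by rewrite big_ord0 min0n.
by rewrite big_ord_recr /= IHc; case: ltnP; lia.
Qed.

Lemma sum_geq_bool c t : \sum_(s < c) (t <= s) = c - t.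
Proof.
elim: c => [|c IHc]; first by rewrite big_ord0.
by rewrite big_ord_recr /= IHc; case: leqP; lia.
Qed.

Lemma eq_of_leq_sum (I : finType) (F G : I -> nat) :
  (forall i, F i <= G i) -> \sum_i F i = \sum_i G i -> forall i, F i = G i.
Proof.
move=> le_FG e_FG i; apply/eqP; rewrite eqn_leq le_FG /= leqNgt; apply/negP => lt_i.
have: \sum_i F i < \sum_i G i; last by rewrite e_FG ltnn.
rewrite [X in X < _](bigD1 i) //= [X in _ < X](bigD1 i) //= -addSn leq_add //.
by apply: leq_sum.
Qed.

(** * Distributions of tokens *)

Section Assignments.
Variables (p n B : nat) (cnt : nat -> nat) (D R : nat) (C : nat -> nat).
Let r j := (R %/ p ^ j) %% p.
Local Notation tail := (tail n B cnt).
Hypotheses (p_gt1 : 1 < p) (n_gt0 : 0 < n).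
Hypotheses (cnt_lt : forall b, cnt b < p) (cnt0 : forall b, B <= b -> cnt b = 0).
Hypotheses (R_lt : R < p ^ n) (C_0 : C 0 = 0) (C_n : C n = 0).
Hypothesis tail_C : forall j, j < n -> tail j 0 + C j = r j + D * p.-1 + p * C j.+1.

Definition token := {b : 'I_B & 'I_(cnt b)}.
Definition pos (x : token) : nat := tag x.
Definition cost x := p ^ (pos x %% n).
(** Numbers the tokens of one type from the highest position down, so that [rank x < N] selects the
    N most valuable ones. *)
Definition rank (x : token) := tail (pos x %% n) (pos x).+1 + tagged x.

Implicit Types f : token -> 'I_D.+1.

Definition valid f := forall l, l < D -> \sum_x (f x == l :> nat) * cost x = (p ^ n).-1.
(** Group l counts l + 1: this shifts the degree by a constant and makes the weight a sum over D + 1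
    levels. *)
Definition wt f := \sum_x (f x).+1 * p ^ pos x.
Definition upcount f i j b := \sum_x (D - i <= f x) * ((pos x %% n == j) * (b <= pos x)).

Let p_gt0 : 0 < p. Proof. exact: ltnW. Qed.

Lemma sum_token (F : nat -> nat -> nat) :
  \sum_(x : token) F (pos x) (tagged x) = \sum_(b < B) \sum_(s < cnt b) F b s.
Proof. by rewrite (sig_big_dep (fun _ => true) (fun _ _ => true) (fun b s => F (val b) (val s))). Qed.

Lemma count_rank j b N :
  \sum_(x : token) (rank x < N) * ((pos x %% n == j) * (b <= pos x)) = minn N (tail j b).
Proof.
rewrite (sum_token (fun c s => (tail (c %% n) c.+1 + s < N) * ((c %% n == j) * (b <= c)))).
rewrite (eq_bigr (fun c : 'I_B => (c %% n == j) * (b <= c) * minn (cnt c) (N - tail j c.+1))); last first.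
  move=> c _; rewrite -big_distrl /= mulnC sum_ltn_bool.
  by case: eqP => [->|_]; rewrite ?mul0n.
rewrite -(big_mkord predT (fun c => (c %% n == j) * (b <= c) * minn (cnt c) (N - tail j c.+1))).
have [le_Bb|lt_bB] := leqP B b.
  rewrite tail_ge // minn0 big_nat_cond big1 // => c /andP[/andP[_ lt_cB] _].
  by rewrite leqNgt (leq_trans lt_cB) // muln0.
rewrite (big_cat_nat (n := b)) ?(ltnW lt_bB) //= big_nat_cond big1 ?add0n; last first.
  by move=> c /andP[/andP[_ lt_cb] _]; rewrite leqNgt lt_cb muln0.
rewrite big_nat (eq_bigr (fun c => (c %% n == j) * minn (cnt c) (N - tail j c.+1))); last first.
  by move=> c /andP[-> _]; rewrite muln1.
rewrite -big_nat; move: (subnKC (ltnW lt_bB)); move: (B - b) => d.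
elim: d b {lt_bB} => [|d IHd] b e_B; first by rewrite tail_ge ?minn0 ?big_geq //; lia.
rewrite big_ltn; last by lia.
rewrite IHd; last by lia.
rewrite (tailS n cnt0 j b); case: eqP => _; last by rewrite !mul0n addn0.
by rewrite !mul1n; move: (tail _ _) (cnt b); clear => *; lia.
Qed.

Lemma rank_lt x : rank x < tail (pos x %% n) 0.
Proof.
apply: leq_trans (tail_le n cnt0 _ (leq0n (pos x))).
by rewrite (tailS n cnt0) eqxx mul1n ltn_add2l.
Qed.

Lemma count_tail j b : \sum_(x : token) (pos x %% n == j) * (b <= pos x) = tail j b.
Proof.
have := count_rank j b (tail j 0); rewrite (minn_idPr (tail_le n cnt0 _ (leq0n b))) => <-.
apply: eq_bigr => x _; case: eqP => [<-|_]; last by rewrite muln0.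
by rewrite rank_lt !mul1n.
Qed.

Lemma sum_levels m : m <= D -> \sum_(i < D.+1) (D - i <= m) = m.+1.
Proof.
move=> le_mD; rewrite (reindex_inj rev_ord_inj) /=.
rewrite (eq_bigr (fun i : 'I_D.+1 => (0 + i < m.+1) : nat)); last first.
  by move=> i _; rewrite subSS subKn // -ltnS.
by rewrite sum_ltn_bool; lia.
Qed.

Lemma sum_weight_le x : \sum_(b < B) weight p b * (b <= pos x) = p ^ pos x.
Proof.
rewrite -(sum_weight p_gt1) (big_ord_widen_cond B predT (weight p)); last exact: ltn_ord.
rewrite [RHS]big_mkcond; apply: eq_bigr => b _ /=; rewrite ltnS.
by case: leqP; rewrite ?muln1 ?muln0.
Qed.

Lemma sum_type x (F : nat -> nat) : \sum_(j < n) (pos x %% n == j) * F j = F (pos x %% n).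
Proof.
rewrite (bigD1 (Ordinal (ltn_pmod (pos x) n_gt0))) //= eqxx mul1n big1 ?addn0 // => j.
by rewrite -val_eqE /= eq_sym => /negPf->.
Qed.

(** Both factors are split into layers: f x + 1 counts the levels containing x, and p^(pos x) is the
    sum of the weights up to its position. *)
Lemma wtE f : wt f = \sum_(i < D.+1) \sum_(j < n) \sum_(b < B) weight p b * upcount f i j b.
Proof.
rewrite (eq_bigr (fun i : 'I_D.+1 => \sum_x (D - i <= f x) * p ^ pos x)); last first.
  move=> i _; rewrite /upcount.
  rewrite (eq_bigr (fun j : 'I_n => \sum_x (D - i <= f x) * ((pos x %% n == j) * p ^ pos x))).
    rewrite exchange_big; apply: eq_bigr => x _ /=.
    by rewrite -big_distrr /= (sum_type x (fun=> p ^ pos x)).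
  move=> j _; rewrite (eq_bigr (fun b : 'I_B => \sum_x (D - i <= f x) *
     ((pos x %% n == j) * (weight p b * (b <= pos x))))).
    rewrite exchange_big; apply: eq_bigr => x _ /=.
    by rewrite -!big_distrr /= sum_weight_le.
  move=> b _; rewrite big_distrr; apply: eq_bigr => x _ /=.
  by rewrite mulnCA; congr (_ * _); rewrite mulnCA.
rewrite exchange_big; apply: eq_bigr => x _ /=.
by rewrite -big_distrl /= sum_levels // -ltnS.
Qed.

Lemma upcount_le f i j b : upcount f i j b <= minn (upcount f i j 0) (tail j b).
Proof.
rewrite leq_min -(count_tail j b); apply/andP; split; apply: leq_sum => x _.
  by rewrite !leq_mul // leq_b1.
by case: (_ <= f x); rewrite ?mul1n.
Qed.

Let typecount f l j := \sum_x (f x == l :> nat) * (pos x %% n == j).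
Let lowcost f l m := \sum_(j < m) p ^ j * typecount f l j.
Let carry f l j := lowcost f l j %/ p ^ j.
(** Adding up the cost of group l in base p carries [carry f l j] into digit j; the carries of the
    top i + 1 groups are added. *)
Definition profile f i j := \sum_(l < D.+1 | D - i <= l) carry f l j.

Lemma lowcost_n f l : lowcost f l n = \sum_x (f x == l :> nat) * cost x.
Proof.
rewrite /lowcost (eq_bigr (fun j : 'I_n => \sum_x (f x == l :> nat) * ((pos x %% n == j) * p ^ j))).
  rewrite exchange_big; apply: eq_bigr => x _ /=.
  by rewrite -big_distrr /= (sum_type x (fun j => p ^ j)).
by move=> j _; rewrite big_distrr; apply: eq_bigr => x _ /=; rewrite mulnCA [p ^ _ * _]mulnC.
Qed.

Lemma digit_telescope (a c : nat -> nat) i :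
  (forall j, j < n -> a j + c j = r j + i * p.-1 + p * c j.+1) -> c 0 = 0 ->
  \sum_(j < n) p ^ j * a j = R %% p ^ n + i * (p ^ n).-1 + p ^ n * c n.
Proof.
move=> ac c0; suff key m : m <= n ->
    \sum_(j < m) p ^ j * a j = R %% p ^ m + i * (p ^ m).-1 + p ^ m * c m by apply: key.
elim: m => [|m IHm] lt_mn; first by rewrite big_ord0 modn1 c0 /= !muln0.
rewrite big_ord_recr /= (IHm (ltnW lt_mn)) -!(sum_digits _ _ p_gt1) big_ord_recr /= -/(r m).
have := ac m lt_mn; move/(congr1 (muln (p ^ m))).
rewrite !mulnDr [p ^ m * (p * _)]mulnA -expnSr [p ^ m * (i * _)]mulnCA.
have -> : (p ^ m.+1).-1 = (p ^ m).-1 + p ^ m * p.-1.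
  rewrite expnSr; have : 0 < p ^ m by rewrite expn_gt0 p_gt0.
  by case: (p ^ m) (p) p_gt0 => [|u] [|v] //= _ _; lia.
rewrite mulnDr; move: (\sum_(_ < _) _) (i * _) (i * _) (_ * c m) (_ * c m.+1) (_ * r m) (_ * a m).
by clear => *; lia.
Qed.

Lemma total_cost : \sum_x cost x = D * (p ^ n).-1 + R.
Proof.
have -> : \sum_x cost x = \sum_(j < n) p ^ j * tail j 0.
  rewrite (eq_bigr (fun j : 'I_n => \sum_x (pos x %% n == j) * p ^ j)).
    by rewrite exchange_big; apply: eq_bigr => x _; rewrite (sum_type x (fun j => p ^ j)).
  by move=> j _; rewrite -big_distrl /= mulnC -(count_tail j 0); congr (_ * _);
     apply: eq_bigr => x _; rewrite muln1.
by rewrite (digit_telescope tail_C C_0) C_n muln0 addn0 modn_small // addnC.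
Qed.

(** * From a valid distribution to a flat feasible profile *)

Section Encode.
Variable f : token -> 'I_D.+1.
Hypothesis f_valid : valid f.

Lemma lowcost_top : lowcost f D n = R.
Proof.
have E : \sum_x cost x = \sum_(l < D.+1) lowcost f l n.
  rewrite (eq_bigr (fun l : 'I_D.+1 => \sum_x (f x == l :> nat) * cost x)).
    rewrite exchange_big; apply: eq_bigr => x _ /=.
    rewrite -big_distrl /= (bigD1 (f x)) //= eqxx big1 ?addn0 ?mul1n // => l.
    by rewrite -val_eqE eq_sym /= => /negPf->.
  by move=> l _; rewrite lowcost_n.
move: E; rewrite total_cost big_ord_recr /= (eq_bigr (fun=> (p ^ n).-1)).
  by rewrite sum_nat_const card_ord => /addnI.
by move=> l _; rewrite lowcost_n f_valid.
Qed.

(** Every group costs less than p^n, so no carry leaves the last type. *)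
Lemma lowcost_small l j : l <= D -> n <= j -> lowcost f l j < p ^ j.
Proof.
move=> le_lD le_nj; have -> : lowcost f l j = lowcost f l n.
  move/subnKC: le_nj => <-; elim: (j - n) => [|d IHd]; first by rewrite addn0.
  rewrite addnS -IHd {1}/lowcost big_ord_recr /= -/(lowcost _ _ _) /typecount big1 ?muln0 ?addn0 // => x _.
  have -> : (pos x %% n == n + d) = false; last by rewrite muln0.
  by apply/eqP => e; have := ltn_pmod (pos x) n_gt0; rewrite e; lia.
apply: (@leq_trans (p ^ n)); last by rewrite leq_exp2l.
move: le_lD; rewrite leq_eqVlt => /orP[/eqP->|lt_lD]; first by rewrite lowcost_top.
by rewrite lowcost_n f_valid // prednK // expn_gt0 p_gt0.
Qed.

(** Sum of [carry_eq] over the groups: a free group has all digits p - 1, the top group has the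
    digits of R. *)
Lemma profile_eq i j : i <= D -> j < n ->
  upcount f i j 0 + profile f i j = r j + i * p.-1 + p * profile f i j.+1.
Proof.
move=> le_iD lt_jn.
have -> : upcount f i j 0 = \sum_(l < D.+1 | D - i <= l) typecount f l j.
  rewrite exchange_big; apply: eq_bigr => x _ /=; rewrite muln1.
  rewrite -big_distrl /=; congr (_ * _); rewrite big_mkcond (bigD1 (f x)) //= eqxx big1 ?addn0.
    by case: (_ <= _).
  by move=> l; rewrite -val_eqE eq_sym /= => /negPf->; case: ifP.
rewrite /profile -big_split big_distrr /=.
rewrite (eq_bigr (fun l : 'I_D.+1 => ((lowcost f l n %/ p ^ j) %% p) + p * carry f l j.+1)); last first.
  by move=> l _; apply: carry_eq.
rewrite big_split /=; congr (_ + _).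
rewrite big_mkcond big_ord_recr /= leq_subr lowcost_top -/(r j) addnC; congr (_ + _).
rewrite (eq_bigr (fun l : 'I_D => (D - i <= l) * p.-1)); last first.
  by move=> l _; rewrite lowcost_n f_valid // digit_pred_exp //; case: ifP; rewrite ?mul1n.
rewrite -big_distrl /=; congr (_ * _).
by rewrite sum_geq_bool subKn.
Qed.

Lemma profile_level i j : i <= D -> j < n -> level p r i (profile f i) j = upcount f i j 0.
Proof. by move=> le_iD lt_jn; rewrite /level -profile_eq // addnK. Qed.

Lemma profile_feasible : feasible p n D r C (profile f) /\ flat p n D r (profile f).
Proof.
have p0 i : profile f i 0 = 0.
  by apply: big1 => l _; rewrite /carry /lowcost big_ord0 div0n.
have pn i j : n <= j -> profile f i j = 0.
  by move=> le_nj; apply: big1 => l _; rewrite /carry divn_small // lowcost_small // -ltnS.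
split; last first.
  move=> i j lt_iD lt_jn; rewrite !profile_level // ?(ltnW lt_iD) //.
  apply: leq_sum => x _; rewrite leq_mul2r; apply/orP; right.
  by have [le_i|_ //] := leqP (D - i) (f x); have -> : D - i.+1 <= f x by lia.
split=> [i le_iD|i j lt_iD|j].
- split=> // [j|j lt_jn]; first exact: pn.
  by rewrite -profile_eq // leq_addl.
- rewrite /profile [X in _ <= X](bigID (fun l : 'I_D.+1 => D - i <= l)) /=.
  rewrite (eq_bigl (fun l : 'I_D.+1 => (D - i.+1 <= l) && (D - i <= l))) ?leq_addr // => l.
  by lia.
elim: j => [|j IHj] lt_jn; first by rewrite p0 C_0.
have := profile_eq (leqnn D) lt_jn; have := tail_C lt_jn.
have -> : upcount f D j 0 = tail j 0.
  by rewrite -count_tail; apply: eq_bigr => x _; rewrite subnn mul1n.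
rewrite IHj ?(ltnW lt_jn) // => -> /addnI/eqP; by rewrite eqn_pmul2l // => /eqP->.
Qed.

Lemma wt_le_total : wt f <= total p n B cnt D r (profile f).
Proof.
rewrite wtE; apply: leq_sum => i _; apply: leq_sum => j _; apply: leq_sum => b _.
by rewrite profile_level ?leq_mul2l ?upcount_le ?orbT // -ltnS.
Qed.

Lemma upcount_opt i j b : wt f = total p n B cnt D r (profile f) -> i <= D -> j < n ->
  upcount f i j b = minn (level p r i (profile f i) j) (tail j b).
Proof.
move=> e_wt le_iD lt_jn; rewrite profile_level //.
have [le_Bb|lt_bB] := leqP B b.
  by rewrite tail_ge // minn0; have := upcount_le f i j b; rewrite tail_ge // minn0 leqn0 => /eqP.
have le0 i' j' b' : i' <= D -> j' < n -> weight p b' * upcount f i' j' b' <=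
   weight p b' * minn (level p r i' (profile f i') j') (tail j' b').
  by move=> h1 h2; rewrite profile_level // leq_mul2l upcount_le orbT.
have lt_iD : i < D.+1 by [].
move: e_wt; rewrite wtE /total => e1.
have le1 (i' : 'I_D.+1) (j' : 'I_n) (b' : 'I_B) : _ := le0 i' j' b' (ltn_ord i') (ltn_ord j').
have e2 := eq_of_leq_sum (fun i' => leq_sum _ (fun j' _ => leq_sum _ (fun b' _ => le1 i' j' b'))) e1
  (Ordinal lt_iD).
have e3 := eq_of_leq_sum (fun j' => leq_sum _ (fun b' _ => le1 (Ordinal lt_iD) j' b')) e2 (Ordinal lt_jn).
have /eqP := eq_of_leq_sum (fun b' => le1 (Ordinal lt_iD) (Ordinal lt_jn) b') e3 (Ordinal lt_bB).
rewrite /= profile_level // eqn_pmul2l => [/eqP //|].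
by case: b {lt_bB e3} => //= b; rewrite subn_gt0 ltn_exp2l.
Qed.

End Encode.

(** * From a flat feasible profile to a valid distribution *)

Section Decode.
Variable K : nat -> nat -> nat.
Hypotheses (fK : feasible p n D r C K) (flK : flat p n D r K).

Let lev i j := level p r i (K i) j.
(** By flatness a token belongs to all levels from some index on, so their number gives its group;
    level D contains every token and is not counted. *)
Let height x := \sum_(i < D) (rank x < lev i (pos x %% n)).
Definition decode x : 'I_D.+1 := inord (height x).

Lemma lev_mono i l j : j < n -> i <= l -> l <= D -> lev i j <= lev l j.
Proof.
move=> lt_jn /subnKC <-; elim: (l - i) => [|d IHd]; first by rewrite addn0.
rewrite addnS => lt_D; exact: leq_trans (IHd (ltnW lt_D)) (flK lt_D lt_jn).
Qed.

Lemma lev_top j : j < n -> lev D j = tail j 0.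
Proof.
move=> lt_jn; have [_ _ eC] := fK; rewrite /lev /level !eC ?(ltnW lt_jn) //.
by have := tail_C lt_jn; move: (r j + _) (p * _) (tail j 0); clear => *; lia.
Qed.

Lemma decodeE x i : i <= D -> (D - i <= decode x) = (rank x < lev i (pos x %% n)).
Proof.
move=> le_iD; have lt_type := ltn_pmod (pos x) n_gt0.
have le_h : height x <= D.
  apply: (@leq_trans (\sum_(l < D) 1)); last by rewrite sum_nat_const card_ord muln1.
  by apply: leq_sum => l _; apply: leq_b1.
rewrite /decode inordK //; move: le_iD; rewrite leq_eqVlt => /orP[/eqP->|lt_iD].
  by rewrite subnn lev_top // rank_lt.
case: ltnP => [lt_x|ge_x].
  rewrite -sum_geq_bool; apply: leq_sum => l _; case: (leqP i l) => // le_il.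
  by rewrite (leq_trans lt_x) // lev_mono // ltnW.
apply/negbTE; rewrite -ltnNge.
suff: height x <= D - i.+1 by lia.
rewrite -sum_geq_bool; apply: leq_sum => l _; case: (ltnP i l) => [_|le_li]; first exact: leq_b1.
rewrite ltnNge (leq_trans _ ge_x) // lev_mono // ltnW //.
Qed.

Lemma decode_upcount i j b : i <= D -> upcount decode i j b = minn (lev i j) (tail j b).
Proof.
move=> le_iD; rewrite -count_rank; apply: eq_bigr => x _.
by rewrite decodeE //; case: eqP => [->|_]; rewrite ?mul0n ?muln0.
Qed.

Lemma decode_wt : wt decode = total p n B cnt D r K.
Proof.
rewrite wtE; apply: eq_bigr => i _; apply: eq_bigr => j _; apply: eq_bigr => b _.
by rewrite decode_upcount // -ltnS.
Qed.

Lemma decode_cost i : i <= D ->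
  \sum_x (D - i <= decode x) * cost x = R + i * (p ^ n).-1.
Proof.
move=> le_iD; have [ok _ _] := fK; have [K0 Kn Kle] := ok i le_iD.
have -> : \sum_x (D - i <= decode x) * cost x = \sum_(j < n) p ^ j * lev i j.
  rewrite [RHS](eq_bigr (fun j : 'I_n => \sum_x (D - i <= decode x) * ((pos x %% n == j) * p ^ j))).
    rewrite exchange_big; apply: eq_bigr => x _ /=.
    by rewrite -big_distrr /= (sum_type x (fun j => p ^ j)).
  move=> j _; have -> : lev i j = upcount decode i j 0.
    by rewrite decode_upcount // (minn_idPl _) // -lev_top // lev_mono.
  by rewrite /upcount big_distrr; apply: eq_bigr => x _ /=; rewrite muln1 mulnCA [p ^ _ * _]mulnC.
rewrite (@digit_telescope (lev i) (K i) i) ?K0 ?Kn // ?muln0 ?addn0 ?modn_small // => j lt_jn.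
by rewrite /lev /level subnK // Kle.
Qed.

Lemma decode_valid : valid decode.
Proof.
move=> l lt_lD; have := decode_cost (leq_subr l D).
have := @decode_cost (D - l.+1) (leq_subr _ _); rewrite !subKn //; last exact: ltnW.
have -> : \sum_x (l <= decode x) * cost x =
    \sum_x (l < decode x) * cost x + \sum_x (decode x == l :> nat) * cost x.
  rewrite -big_split; apply: eq_bigr => x _ /=; rewrite -mulnDl; congr (_ * _).
  by case: ltngtP.
have -> : D - l = (D - l.+1).+1 by lia.
by rewrite mulSn => ->; lia.
Qed.

End Decode.

Lemma valid_exists : exists f, valid f.
Proof.
have [K [fK flK]] := feasible_exists p_gt1 n_gt0 C_0 C_n tail_C.
by exists (decode K); apply: decode_valid.
Qed.

(** Distributions of maximal weight have optimal flat profiles, which coincide; the profile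
    determines how many tokens of each position lie in each group. *)
Lemma optimal_counts f g : valid f -> valid g ->
  (forall h, valid h -> wt h <= wt f) -> (forall h, valid h -> wt h <= wt g) ->
  forall b l, \sum_x (f x == l :> nat) * (pos x == b) = \sum_x (g x == l :> nat) * (pos x == b).
Proof.
move=> vf vg of' og b l.
(* Any feasible profile can be flattened without loss and then decoded. *)
have maxM K : feasible p n D r C K -> total p n B cnt D r K <= wt f.
  move=> /(flatten (B := B) (cnt := cnt) p_gt1 n_gt0 cnt0 C_0 C_n tail_C)[K' [fK' flK' le_K]].
  by apply: leq_trans le_K _; rewrite -decode_wt //; apply: of'; apply: decode_valid.
have efg : wt f = wt g by apply/eqP; rewrite eqn_leq of' // og.
have [ff flf] := profile_feasible vf; have [fg flg] := profile_feasible vg.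
have tf : wt f = total p n B cnt D r (profile f).
  by apply/eqP; rewrite eqn_leq wt_le_total // maxM.
have tg : wt g = total p n B cnt D r (profile g).
  by apply/eqP; rewrite eqn_leq wt_le_total // -efg maxM.
have eK := optimum_unique p_gt1 n_gt0 cnt_lt cnt0 C_0 C_n tail_C maxM ff flf (esym tf) fg flg
   (etrans (esym tg) (esym efg)).
have eup i j c : i <= D -> j < n -> upcount f i j c = upcount g i j c.
  move=> le_iD lt_jn; rewrite !upcount_opt //; congr minn.
  by rewrite /level !eK ?(ltnW lt_jn).
have epos i : i <= D -> \sum_x (D - i <= f x) * (pos x == b) = \sum_x (D - i <= g x) * (pos x == b).
  move=> le_iD; have lt_b := ltn_pmod b n_gt0.
  have E h : upcount h i (b %% n) b =
      upcount h i (b %% n) b.+1 + \sum_x (D - i <= h x) * (pos x == b).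
    rewrite -big_split; apply: eq_bigr => x _ /=; rewrite -mulnDr; congr (_ * _).
    have [->|ne] := eqVneq (pos x) b; first by rewrite eqxx leqnn ltnn.
    by have -> : (b < pos x) = (b <= pos x) by [lia]; rewrite addn0.
  by have := eup i _ b le_iD lt_b; rewrite !E (eup _ _ _ le_iD lt_b) => /addnI.
have [lt_Dl|le_lD] := ltnP D l.
  have no (h : token -> 'I_D.+1) : \sum_x (h x == l :> nat) * (pos x == b) = 0 :> nat.
    apply: big1 => x _; have -> : (h x == l :> nat) = false; last by [].
    by apply/eqP => e; have := ltn_ord (h x); rewrite e ltnS leqNgt lt_Dl.
  by rewrite !no.
have eqs (h : token -> 'I_D.+1) : \sum_x (l <= h x) * (pos x == b) =
    \sum_x (l < h x) * (pos x == b) + \sum_x (h x == l :> nat) * (pos x == b).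
  rewrite -big_split; apply: eq_bigr => x _ /=; rewrite -mulnDl; congr (_ * _).
  by case: ltngtP.
have := epos (D - l) (leq_subr _ _); rewrite subKn // !eqs.
have -> : \sum_x (l < f x) * (pos x == b) = \sum_x (l < g x) * (pos x == b); last by move/addnI.
move: le_lD; rewrite leq_eqVlt => /orP[/eqP->|lt_lD].
  by rewrite !big1 // => x _; rewrite ltnNge -ltnS ltn_ord.
by have := epos (D - l.+1) (leq_subr _ _); rewrite subKn.
Qed.

End Assignments.

(** * Counting the optimal distributions *)

Section Orbit.
Variables (T I : finType) (pos : T -> nat) (p : nat).
Hypotheses (p_pr : prime p) (fiber_lt : forall b, #|[pred x | pos x == b]| < p).

Definition pos_perms := [set s : {perm T} | [forall x, pos (s x) == pos x]].

Lemma pos_perms_group_set : group_set pos_perms.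
Proof.
apply/group_setP; split=> [|s t]; first by rewrite inE; apply/forallP => x; rewrite perm1.
rewrite !inE => /forallP hs /forallP ht; apply/forallP => x.
by rewrite permM (eqP (ht _)).
Qed.
Canonical pos_perms_group := Group pos_perms_group_set.

Lemma pos_permsX s i x : s \in pos_perms -> pos ((s ^+ i)%g x) = pos x.
Proof.
rewrite inE => /forallP hs; elim: i => [|i IHi]; first by rewrite expg0 perm1.
by rewrite expgSr permM (eqP (hs _)).
Qed.

(** An element of order p has cycles of length 1 or p, but each cycle lies in a fibre of fewer than
    p elements. *)
Lemma pos_perms_coprime : ~~ (p %| #|pos_perms|).
Proof.
apply/negP => /(Cauchy p_pr)[s sH os].
suff s1 : s = 1%g by move: os (prime_gt1 p_pr); rewrite s1 order1 => <-.
apply/permP => x; rewrite perm1.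
have : #|porbit s x| %| p by rewrite porbitE -os dvdn_orbit.
have /primeP[_ H] := p_pr => /H/orP[|/eqP e_p].
  move=> /cards1P[y ey]; have := mem_porbit s 1 x; have := porbit_id s x.
  by rewrite ey !inE => /eqP {1}<- /eqP.
have := fiber_lt (pos x); rewrite -e_p ltnNge; case/negP.
apply: subset_leq_card; apply/subsetP => y /porbitP[i ->].
by rewrite inE pos_permsX.
Qed.

Definition relabel (f : {ffun T -> I}) (s : {perm T}) := [ffun x => f (s^-1 x)%g].

Lemma relabel1 : relabel^~ 1%g =1 id.
Proof. by move=> f; apply/ffunP => x; rewrite ffunE invg1 perm1. Qed.

Lemma relabelM f : act_morph relabel f.
Proof. by move=> s t; apply/ffunP => x; rewrite !ffunE invMg permM. Qed.

Definition relabel_action := TotalAction relabel1 relabelM.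

(** Equal counts make the sequences of pairs (position, label) rearrangements of each other; the
    rearranging permutation preserves positions. *)
Lemma same_counts_orbit (f g : {ffun T -> I}) :
  (forall b l, #|[pred x | (f x == l) && (pos x == b)]| = #|[pred x | (g x == l) && (pos x == b)]|) ->
  f \in orbit relabel_action pos_perms g.
Proof.
move=> fg; pose key (h : {ffun T -> I}) (i : 'I_#|T|) := (pos (enum_val i), h (enum_val i)).
have /tuple_permP[s es] : perm_eq (mktuple (key f)) (mktuple (key g)).
  have cnt h b l : count_mem (b, l) (mktuple (key h)) = #|[pred x | (h x == l) && (pos x == b)]|.
    rewrite count_map val_ord_tuple enumT -size_filter.
    transitivity #|[pred i | key h i == (b, l)]|; first by rewrite [RHS]cardE /enum_mem.
    rewrite -(card_imset _ (@enum_val_inj T T)); apply: eq_card => x.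
    apply/imsetP/idP => [[i]|]; rewrite !inE.
      by rewrite xpair_eqE => /andP[/eqP e1 /eqP e2] ->; rewrite e1 e2 !eqxx.
    move=> /andP[/eqP e1 /eqP e2]; exists (enum_rank x); last by rewrite enum_rankK.
    by rewrite inE /key /= enum_rankK e1 e2.
  by apply/allP => -[b l] _ /=; rewrite !cnt fg.
pose t x := enum_val (s (enum_rank x)).
have t_inj : injective t.
  by move=> x y /enum_val_inj/perm_inj/enum_rank_inj.
have key_t x : pos (t x) = pos x /\ g (t x) = f x.
  have := congr1 (fun u => nth (key f (enum_rank x)) u (enum_rank x)) es.
  rewrite -[LHS](@tnth_nth _ _ _ (mktuple (key f))) tnth_mktuple.
  rewrite -(@tnth_nth _ _ _ [tuple tnth (mktuple (key g)) (s i) | i < #|T|]).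
  by rewrite !tnth_mktuple /key enum_rankK -/(t x) => -[-> ->].
apply/orbitP; exists (perm t_inj)^-1%g.
  by rewrite groupV inE; apply/forallP => x; rewrite permE; have [-> _] := key_t x.
by apply/ffunP => x; rewrite ffunE invgK permE; have [_ ->] := key_t x.
Qed.

Lemma same_counts_card (O : {set {ffun T -> I}}) : O != set0 ->
  (forall f s, f \in O -> s \in pos_perms -> relabel f s \in O) ->
  (forall f g, f \in O -> g \in O -> forall b l,
     #|[pred x | (f x == l) && (pos x == b)]| = #|[pred x | (g x == l) && (pos x == b)]|) ->
  ~~ (p %| #|O|).
Proof.
move=> /set0Pn[g gO] closed same.
have -> : O = orbit relabel_action pos_perms g.
  apply/setP => f; apply/idP/idP => [fO|/orbitP[s sH <-]]; last exact: closed.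
  by apply: same_counts_orbit; apply: same.
apply: contra pos_perms_coprime => /dvdn_trans; apply.
exact: (dvdn_orbit relabel_action pos_perms_group g).
Qed.

End Orbit.

(** * Digit sums *)

Definition digit p m b := (m %/ p ^ b) %% p.

Lemma digit_ge p m b B : 1 < p -> m < p ^ B -> B <= b -> digit p m b = 0.
Proof.
move=> p1 lt_m le_Bb; rewrite /digit divn_small ?mod0n //.
by apply: leq_trans lt_m _; rewrite leq_exp2l.
Qed.

Lemma sum_digitsE p m B : 1 < p -> m < p ^ B -> \sum_(b < B) digit p m b * p ^ b = m.
Proof.
move=> p1 lt_m; rewrite -[RHS](modn_small lt_m) -(sum_digits _ _ p1).
by apply: eq_bigr => b _; rewrite mulnC.
Qed.

Lemma sum_digit_widen p m B B' (g : nat -> nat) : 1 < p -> m < p ^ B -> m < p ^ B' ->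
  \sum_(b < B) digit p m b * g b = \sum_(b < B') digit p m b * g b.
Proof.
move=> p1; wlog le_B : B B' / B <= B'.
  move=> H lt_B lt_B'; case: (leqP B B') => [le|/ltnW le]; first exact: H.
  by apply/esym/H.
move=> lt_B _; rewrite (big_ord_widen B' (fun b => digit p m b * g b) le_B).
rewrite big_mkcond; apply: eq_bigr => b _; case: ltnP => // le_Bb.
by rewrite (digit_ge p1 lt_B le_Bb).
Qed.

Lemma digsum_auxE b fuel m E : 1 < b -> m <= fuel -> m < b ^ E ->
  digsum_aux fuel b m = \sum_(e < E) (m %/ b ^ e) %% b.
Proof.
move=> b1; elim: fuel m E => [|fuel IH] m E /=.
  by rewrite leqn0 => /eqP-> _; rewrite big1 // => e _; rewrite div0n mod0n.
have [-> _ _|m0 le_m lt_m] := eqVneq m 0.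
  by rewrite big1 // => e _; rewrite div0n mod0n.
case: E lt_m => [|E] lt_m; first by move: m0; rewrite -leqn0 -ltnS -(expn0 b) lt_m.
rewrite big_ord_recl expn0 divn1 (IH _ E).
- by congr (_ + _); apply: eq_bigr => e _; rewrite -divnMA -expnS.
- by rewrite -ltnS; apply: leq_trans le_m; rewrite ltn_Pdiv // lt0n.
- by rewrite ltn_divLR ?(ltnW b1) // -expnSr.
Qed.

Lemma digsumE p n m E : 1 < p -> 0 < n -> m < p ^ (n * E) ->
  digsum (p ^ n) m = \sum_(b < n * E) digit p m b * p ^ (b %% n).
Proof.
move=> p1 n0 lt_m; rewrite /digsum (@digsum_auxE _ _ _ E) //; last by rewrite -expnM.
  elim: E {lt_m} => [|E IHE]; first by rewrite muln0 !big_ord0.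
  rewrite mulnS addnC big_ord_recr big_split_ord IHE /=; congr (_ + _).
  rewrite -(sum_digits _ _ p1); apply: eq_bigr => j _.
  rewrite mulnC /digit -expnM -divnMA -expnD; congr (_ * p ^ _).
  by rewrite mulnC modnMDl modn_small.
by rewrite -(exp1n n) ltn_exp2r.
Qed.

Lemma digit_mulX p m i b : 0 < p -> digit p (p ^ i * m) (i + b) = digit p m b.
Proof. by move=> p0; rewrite /digit expnD divnMl // expn_gt0 p0. Qed.

Lemma digit_mulX0 p m i b : 0 < p -> b < i -> digit p (p ^ i * m) b = 0.
Proof.
move=> p0 lt_bi; rewrite /digit -(subnKC (ltnW lt_bi)) expnD -mulnA mulKn ?expn_gt0 ?p0 //.
have -> : i - b = (i - b.+1).+1 by lia.
by rewrite expnS -mulnA modnMr.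
Qed.

(** Multiplication by p^i shifts the base-p digits and so rotates the types by i. *)
Lemma digsum_mulX p n m i B : 1 < p -> 0 < n -> m < p ^ B ->
  digsum (p ^ n) (p ^ i * m) = \sum_(b < B) digit p m b * p ^ ((b + i) %% n).
Proof.
move=> p1 n0 lt_m; have p0 := ltnW p1.
have lt_im : p ^ i * m < p ^ (n * (i + B)).
  apply: (@leq_trans (p ^ (i + B))); last by rewrite leq_exp2l // leq_pmull.
  by rewrite expnD ltn_pmul2l // expn_gt0 p0.
have lt_im' : p ^ i * m < p ^ (i + B) by rewrite expnD ltn_pmul2l // expn_gt0 p0.
rewrite (digsumE p1 n0 lt_im) (sum_digit_widen (fun b => p ^ (b %% n)) p1 lt_im lt_im').
rewrite big_split_ord /= big1 ?add0n; last by move=> b _; rewrite digit_mulX0.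
by apply: eq_bigr => b _; rewrite digit_mulX // addnC.
Qed.

Lemma digit_addX p m1 m2 N b : 1 < p -> m1 < p ^ N ->
  digit p (m1 + p ^ N * m2) b = if b < N then digit p m1 b else digit p m2 (b - N).
Proof.
move=> p1 lt_m; have p0 := ltnW p1; rewrite /digit; case: ltnP => [lt_bN|le_Nb].
  rewrite -(subnKC (ltnW lt_bN)) expnD -mulnA [p ^ b * _]mulnC divnDMl ?expn_gt0 ?p0 //.
  have -> : N - b = (N - b.+1).+1 by lia.
  by rewrite expnS -mulnA -modnDmr modnMr addn0.
by rewrite -{1}(subnKC le_Nb) expnD divnMA mulnC divnDMl ?expn_gt0 ?p0 // (divn_small lt_m).
Qed.

(** The digits are juxtaposed, and a shift by a multiple of n preserves the types. *)
Lemma digsum_addX p n i m1 m2 N B : 1 < p -> 0 < n -> m1 < p ^ (n * N) -> m2 < p ^ B ->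
  digsum (p ^ n) (p ^ i * (m1 + p ^ (n * N) * m2)) =
  digsum (p ^ n) (p ^ i * m1) + digsum (p ^ n) (p ^ i * m2).
Proof.
move=> p1 n0 lt1 lt2; have p0 := ltnW p1.
have lt : m1 + p ^ (n * N) * m2 < p ^ (n * N + B).
  rewrite expnD; apply: (@leq_trans (p ^ (n * N) * m2.+1)); first by rewrite mulnS ltn_add2r.
  by rewrite leq_mul2l lt2 orbT.
rewrite (digsum_mulX i p1 n0 lt) (digsum_mulX i p1 n0 lt1) (digsum_mulX i p1 n0 lt2).
rewrite big_split_ord /=; congr (_ + _); apply: eq_bigr => b _; rewrite digit_addX //.
  by rewrite ltn_ord.
rewrite ltnNge leq_addr /= addKn; congr (_ * p ^ _).
by rewrite -addnA mulnC modnMDl.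
Qed.

Lemma sum_ord_split (G : nat -> nat) j n : j <= n ->
  \sum_(i < n) G i = \sum_(i < j) G i + \sum_(i < n - j) G (j + i).
Proof.
move=> le_jn; have [d ->] : exists d, n = j + d by exists (n - j); rewrite subnKC.
by rewrite big_split_ord addKn.
Qed.

(** * Final carries from the minimality of the digit sum *)

Section Carries.
Variables (p n D R : nat) (A : nat -> nat).
Hypotheses (p_gt1 : 1 < p) (n_gt0 : 0 < n) (R_lt : R < (p ^ n).-1).
Hypothesis costA : \sum_(j < n) A j * p ^ j = D * (p ^ n).-1 + R.
Hypothesis rotA : forall i, D * (p ^ n).-1 <= \sum_(j < n) A j * p ^ ((j + i) %% n).

Let lo m := \sum_(j < m) A j * p ^ j.
Definition carries j := (lo j + D - D * p ^ j) %/ p ^ j.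

Lemma carries_split j : j <= n -> exists2 h, lo n = lo j + p ^ j * h
  & \sum_(i < n) A i * p ^ ((i + (n - j)) %% n) = p ^ (n - j) * lo j + h.
Proof.
move=> le_jn; exists (\sum_(i < n - j) A (j + i) * p ^ i).
  rewrite /lo (sum_ord_split (fun i => A i * p ^ i) le_jn) big_distrr /=; congr (_ + _).
  by apply: eq_bigr => i _; rewrite expnD mulnCA.
rewrite (sum_ord_split (fun i => A i * p ^ ((i + (n - j)) %% n)) le_jn) big_distrr /=; congr (_ + _); apply: eq_bigr => i _.
  rewrite /= modn_small; last by have := ltn_ord i; lia.
  by rewrite addnC expnD mulnCA.
congr (_ * p ^ _); rewrite /=.
have -> : j + i + (n - j) = n + i by lia.
by rewrite modnDl modn_small // (leq_trans (ltn_ord i)) // leq_subr.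
Qed.

Lemma lo_ge j : j <= n -> D * p ^ j <= lo j + D.
Proof.
move=> le_jn; have [h e1 e2] := carries_split le_jn.
have := rotA (n - j); rewrite e2; rewrite /lo costA -/(lo j) in e1.
rewrite -(leq_pmul2l (m := p ^ j)) ?expn_gt0 ?(ltnW p_gt1) //.
rewrite mulnDr [p ^ j * (p ^ _ * _)]mulnA -expnD subnKC // => H.
rewrite leqNgt; apply/negP => lt.
have q_gt0 : 0 < p ^ n by rewrite expn_gt0 ltnW.
have : (p ^ n).-1 * (lo j + D).+1 <= (p ^ n).-1 * (D * p ^ j) by rewrite leq_mul2l lt orbT.
move: H; rewrite -(prednK q_gt0).
move: (p ^ j * h) (p ^ j) ((p ^ n).-1) (lo j) e1 R_lt => a b q l e1 Rq; rewrite !succnK => H1 H2.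
have E : b * (D * q) = q * (D * b) by rewrite mulnCA mulnA mulnC.
rewrite E in H1; move: H1 H2; rewrite mulSn mulnS mulnDr [D * q]mulnC in e1 *.
by move: (q * (D * b)) (q * l) (q * D) e1; lia.
Qed.

Lemma carriesP : [/\ carries 0 = 0, carries n = 0 & forall j, j < n ->
  A j + carries j = (R %/ p ^ j) %% p + D * p.-1 + p * carries j.+1].
Proof.
have pX m : 0 < p ^ m by rewrite expn_gt0 ltnW.
(* The numerator is congruent to R modulo p^j, because the total is R + D(q - 1). *)
have y_mod j : j <= n -> lo j + D - D * p ^ j = p ^ j * carries j + R %% p ^ j.
  move=> le_jn; rewrite /carries {1}(divn_eq (lo j + D - _) (p ^ j)) mulnC; congr (_ + _).
  have [h e1 _] := carries_split le_jn; have ge := lo_ge le_jn; rewrite /lo costA -/(lo j) in e1.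
  have: lo j + D - D * p ^ j + (D + h) * p ^ j = R + (D * p ^ (n - j)) * p ^ j.
    rewrite -mulnA -expnD subnK // mulnDl [h * _]mulnC.
    have E : D * (p ^ n).-1 + D = D * p ^ n by rewrite -mulnSr prednK.
    by move: (D * _) (D * p ^ n) (D * p ^ j) (p ^ j * h) ge e1 E => *; lia.
  by move/(congr1 (modn^~ (p ^ j))); rewrite ![_ + _ * p ^ j]addnC !modnMDl.
split.
- by rewrite /carries /lo big_ord0 add0n expn0 muln1 subnn.
- rewrite /carries /lo costA; have E : D * (p ^ n).-1 + D = D * p ^ n by rewrite -mulnSr prednK.
  rewrite addnAC E addKn divn_small //.
  by apply: ltn_trans R_lt _; rewrite prednK.
move=> j lt_jn; apply/eqP; rewrite -(eqn_pmul2l (pX j)); apply/eqP.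
have y1 := y_mod j (ltnW lt_jn); have y2 := y_mod j.+1 lt_jn.
have g1 := lo_ge (ltnW lt_jn); have g2 := lo_ge lt_jn.
have l1 : lo j.+1 = lo j + p ^ j * A j by rewrite /lo big_ord_recr /= [A j * _]mulnC.
have r1 : R %% p ^ j.+1 = R %% p ^ j + p ^ j * ((R %/ p ^ j) %% p).
  by rewrite -!(sum_digits _ _ p_gt1) big_ord_recr.
have d1 : D * p ^ j.+1 = D * p ^ j + p ^ j * (D * p.-1).
  by rewrite expnSr [p ^ j * (D * _)]mulnCA -mulnDr -mulnS prednK // ltnW.
rewrite !mulnDr [p ^ j * (p * _)]mulnA -expnSr.
rewrite l1 r1 d1 in y2 g2; move: y1 y2 g1 g2.
move: (p ^ j * A j) (p ^ j * carries j) (p ^ j * ((R %/ p ^ j) %% p)) (p ^ j * (D * p.-1))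
  (p ^ j.+1 * carries j.+1) (R %% p ^ j) (D * p ^ j) (lo j).
by clear => *; lia.
Qed.

End Carries.

(** * Power sums *)

Import GRing.Theory.
Local Open Scope ring_scope.

Lemma sum_exp_pchar (R : comNzRingType) p b (I : finType) (G : I -> R) :
  p \in [pchar R] -> (\sum_i G i) ^+ (p ^ b) = \sum_i G i ^+ (p ^ b).
Proof.
move=> pR; have p_pr : prime p by case/andP: pR.
apply: (big_morph (fun x => x ^+ (p ^ b))) => [x y|]; last first.
  by rewrite expr0n expn_eq0 (gtn_eqF (prime_gt0 p_pr)).
by apply: exprDn_pchar; rewrite pnatX pnatE // pR.
Qed.

Section PowerSums.
Variable F : finFieldType.

Lemma natr_card : #|F|%:R = 0 :> F.
Proof.
have: \sum_(a : F) a = \sum_(a : F) (a + 1) by rewrite [LHS](reindex_inj (addIr 1)).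
rewrite big_split /= sumr_const; set s := \sum_a a => e.
by apply: (@addrI _ s); rewrite addr0 -e.
Qed.

(** For v > 0, multiplication by a generator g permutes F and scales the sum by g^v, which is not 1.
    For v = 0 the sum is the cardinality of F, zero in F. *)
Lemma power_sum0 v : ~~ ((0 < v)%N && (#|F|.-1 %| v)%N) -> \sum_(a : F) a ^+ v = 0.
Proof.
have [->|v_gt0] := posnP v.
  by move=> _; under eq_bigr do rewrite expr0; rewrite sumr_const natr_card.
move=> /= ndvd; have /cyclicP[g Fg] := field_unit_group_cyclic [set: {unit F}]%G.
have gv : (FinRing.uval g) ^+ v != 1.
  apply: contra ndvd => /eqP gv1; rewrite -card_finField_unit Fg -[#|_|]/#[g]%g order_dvdn.
  by apply/eqP; apply: val_inj; rewrite /= FinRing.val_unitX.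
have g0 : FinRing.uval g != 0 by rewrite -unitfE; apply: valP.
have E : FinRing.uval g ^+ v * \sum_(a : F) a ^+ v = \sum_(a : F) a ^+ v.
  rewrite [RHS](reindex_inj (mulfI g0)) big_distrr /=; apply: eq_bigr => a _.
  by rewrite exprMn.
apply/eqP; have: (FinRing.uval g ^+ v - 1) * \sum_(a : F) a ^+ v == 0.
  by rewrite mulrBl E mul1r subrr.
by rewrite mulf_eq0 subr_eq0 (negPf gv).
Qed.

Lemma power_sumN1 v : (0 < v)%N -> (#|F|.-1 %| v)%N -> \sum_(a : F) a ^+ v = -1.
Proof.
move=> v_gt0 /dvdnP[k e_v].
rewrite (bigD1 0) //= expr0n (gtn_eqF v_gt0) add0r.
rewrite (eq_bigr (fun _ => 1)) => [|a a0]; last first.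
  rewrite e_v mulnC exprM; suff -> : a ^+ #|F|.-1 = 1 by rewrite expr1n.
  apply: (mulfI a0); rewrite -exprS prednK ?expf_card ?mulr1 //.
  exact: ltnW (finNzRing_gt1 F).
rewrite sumr_const (eq_card (B := predC1 (0 : F))) // cardC1.
apply/eqP; rewrite -subr_eq0 opprK -mulrSr prednK ?natr_card //.
exact: ltnW (finNzRing_gt1 F).
Qed.

End PowerSums.

Section Expansion.
Variables (F : finFieldType) (R : comNzRingType) (iota : {rmorphism F -> R}).

(* The coefficients of [monic_of c], including the leading one. *)
Definition full_coef d (c : {ffun 'I_d -> F}) (i : 'I_d.+1) : F :=
  oapp c 1 (unlift ord_max i).

Lemma full_coef_max d (c : {ffun 'I_d -> F}) : full_coef c ord_max = 1.
Proof. by rewrite /full_coef unlift_none. Qed.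

Lemma full_coef_widen d (c : {ffun 'I_d -> F}) i :
  full_coef c (widen_ord (leqnSn d) i) = c i.
Proof.
rewrite /full_coef (_ : widen_ord _ i = lift ord_max i) ?liftK //.
by apply: val_inj; rewrite /= /bump leqNgt ltn_ord.
Qed.

(** Choosing an index f x in every factor separates the sums over the free coefficients; the leading
    coefficient 1 leaves group d unconstrained. *)
Lemma expand_product (T : finType) d (e : T -> nat) (z : T -> 'I_d.+1 -> R) :
  \sum_(c : {ffun 'I_d -> F}) \prod_x \sum_i iota (full_coef c i) ^+ e x * z x i =
  \sum_(f : {ffun T -> 'I_d.+1})
    (\prod_(i < d) iota (\sum_(a : F) a ^+ (\sum_x (f x == i :> nat) * e x)%N))
    * \prod_x z x (f x).
Proof.
under eq_bigr do rewrite bigA_distr_bigA.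
rewrite exchange_big; apply: eq_bigr => f _ /=.
under eq_bigr do rewrite big_split /=.
rewrite -big_distrl /=; congr (_ * _).
rewrite (eq_bigr (fun c : {ffun 'I_d -> F} =>
   \prod_(i < d) iota (c i) ^+ (\sum_x (f x == i :> nat) * e x)%N)).
  rewrite -(bigA_distr_bigA (fun (i : 'I_d) (a : F) => iota a ^+ (\sum_x (f x == i :> nat) * e x)%N)).
  apply: eq_bigr => i _; rewrite rmorph_sum; apply: eq_bigr => a _.
  by rewrite rmorphXn.
move=> c _; rewrite (partition_big f predT) //= big_ord_recr /= [X in _ * X]big1 ?mulr1.
  apply: eq_bigr => i _; rewrite (eq_bigr (fun x => iota (c i) ^+ e x)).
    rewrite prodrXr; congr (_ ^+ _); rewrite big_mkcond; apply: eq_bigr => x _.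
    by rewrite -val_eqE /=; case: eqP => _; rewrite ?mul1n.
  by move=> x /eqP->; rewrite full_coef_widen.
by move=> x /eqP->; rewrite full_coef_max rmorph1 expr1n.
Qed.

End Expansion.

Lemma monic_of_full (F : finFieldType) d (c : {ffun 'I_d -> F}) :
  monic_of c = \sum_(i < d.+1) (full_coef c i)%:P * 'X^i.
Proof.
rewrite /monic_of big_ord_recr /= full_coef_max mul1r addrC; congr (_ + _).
by apply: eq_bigr => i _; rewrite full_coef_widen mul_polyC.
Qed.

Lemma expX_pchar_monic (F : finFieldType) (R : comNzRingType) (phi : {rmorphism {poly F} -> R})
    p b d (c : {ffun 'I_d -> F}) : p \in [pchar R] ->
  phi (monic_of c) ^+ (p ^ b) =
  \sum_(i < d.+1) (phi \o polyC) (full_coef c i) ^+ (p ^ b) * phi 'X ^+ (i * p ^ b).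
Proof.
move=> pR; rewrite monic_of_full rmorph_sum /= sum_exp_pchar //; apply: eq_bigr => i _.
by rewrite rmorphM /= exprMn rmorphXn /= exprM.
Qed.

Section DigitTokens.
Variables (p n : nat).
Hypotheses (p_gt1 : (1 < p)%N) (n_gt0 : (0 < n)%N).

Lemma exp_tokens (R : comNzRingType) (y : R) m B : (m < p ^ B)%N ->
  y ^+ m = \prod_(x : token B (digit p m)) y ^+ (p ^ pos x).
Proof.
move=> lt_m; rewrite prodrXr; congr (_ ^+ _).
rewrite (@sum_token B (digit p m) (fun b s => p ^ b)%N) -[LHS](sum_digitsE p_gt1 lt_m).
by apply: eq_bigr => b _; rewrite sum_nat_const card_ord.
Qed.

Lemma sum_cost_tokens m B : (m < p ^ B)%N ->
  (\sum_(x : token B (digit p m)) cost p n x)%N = digsum (p ^ n) m.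
Proof.
move=> lt_m; rewrite -[m in RHS]mul1n -(expn0 p) (digsum_mulX 0 p_gt1 n_gt0 lt_m).
rewrite (@sum_token B (digit p m) (fun b s => p ^ (b %% n))%N).
by apply: eq_bigr => b _; rewrite sum_nat_const card_ord addn0.
Qed.

Lemma expn_mod_pred b : p ^ b = p ^ (b %% n) %[mod (p ^ n).-1].
Proof.
have q1 : p ^ n = 1 %[mod (p ^ n).-1].
  have q_gt0 : (0 < p ^ n)%N by rewrite expn_gt0 ltnW.
  by rewrite -{1}(prednK q_gt0) -addn1 modnDl.
have -> : (p ^ b = (p ^ n) ^ (b %/ n) * p ^ (b %% n))%N.
  by rewrite -expnM -expnD mulnC -divn_eq.
by rewrite -modnMml -modnXm q1 modnXm exp1n modnMml mul1n.
Qed.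

(** As p^n is 1 modulo p^n - 1, exponents may be replaced by costs in both tests. *)
Lemma fiber_cost (T : finType) (pos : T -> nat) (P : pred T) :
  ((0 < \sum_x P x * p ^ pos x) = (0 < \sum_x P x * p ^ (pos x %% n)))%N /\
  (((p ^ n).-1 %| \sum_x P x * p ^ pos x) = ((p ^ n).-1 %| \sum_x P x * p ^ (pos x %% n)))%N.
Proof.
split.
  rewrite !lt0n !sum_nat_eq0; congr (~~ _); apply: eq_forallb => x /=.
  by rewrite !muln_eq0 !expn_eq0 (gtn_eqF (ltnW p_gt1)).
rewrite /dvdn; congr (_ == _).
apply: (big_ind2 (fun u v => u %% (p ^ n).-1 = v %% (p ^ n).-1)%N) => // [u1 u2 v1 v2 e1 e2|x _].
  by rewrite -modnDm e1 e2 modnDm.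
by rewrite -modnMmr expn_mod_pred modnMmr.
Qed.

Lemma sum_fibers_le (T : finType) d (f : T -> 'I_d.+1) (g : T -> nat) :
  (\sum_(l < d) \sum_x (f x == l :> nat) * g x <= \sum_x g x)%N.
Proof.
rewrite exchange_big; apply: leq_sum => x _ /=; rewrite -big_distrl /=.
rewrite -[X in (_ <= X)%N]mul1n leq_mul2r; apply/orP; right.
have [lt_f|ge_f] := ltnP (f x) d.
  rewrite (bigD1 (Ordinal lt_f)) //= eqxx big1 // => l.
  by rewrite -val_eqE /= eq_sym => /negPf->.
by rewrite big1 // => l _; rewrite gtn_eqF // (leq_trans (ltn_ord l)).
Qed.

Lemma tail_sum B (cnt g : nat -> nat) :
  (\sum_(j < n) tail n B cnt j 0 * g j = \sum_(b < B) cnt b * g (b %% n))%N.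
Proof.
rewrite (eq_bigr (fun j : 'I_n => \sum_(b < B) (b %% n == j) * (cnt b * g j))%N).
  rewrite exchange_big; apply: eq_bigr => b _ /=.
  rewrite (bigD1 (Ordinal (ltn_pmod b n_gt0))) //= eqxx mul1n big1 ?addn0 // => j.
  by rewrite -val_eqE /= eq_sym => /negPf->.
move=> j _; rewrite /tail big_mkord big_mkcond big_distrl; apply: eq_bigr => b _ /=.
by case: eqP => _; rewrite ?mul1n ?mul0n.
Qed.

End DigitTokens.

(** * Vanishing and nonvanishing of the power sums *)

Section Main.
Variables (F : finFieldType) (p n : nat).
Hypotheses (p_pr : prime p) (n_gt0 : (0 < n)%N) (cardF : #|F| = (p ^ n)%N).

Let p_gt1 : (1 < p)%N. Proof. exact: prime_gt1. Qed.
Let pF : p \in [pchar F]. Proof. exact: card_finPcharP cardF p_pr. Qed.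
Let pPF : p \in [pchar {poly F}]. Proof. by rewrite pchar_poly. Qed.
Let pPPF : p \in [pchar {poly {poly F}}]. Proof. by rewrite pchar_poly. Qed.
Let lt_pX m : (m < p ^ m)%N. Proof. exact: ltn_expl. Qed.

Lemma S_d_vanish beta k d :
  (digsum (p ^ n) beta + digsum (p ^ n) k < d * (p ^ n).-1)%N -> S_d F beta k d = 0.
Proof.
move=> small; pose Tb := token beta (digit p beta); pose Tk := token k (digit p k).
(* The tokens of beta carry powers of t, those of k powers of theta. *)
pose e (x : Tb + Tk) : nat := match x with inl y => pos y | inr y => pos y end.
pose chi : {rmorphism {poly F} -> {poly {poly F}}} := map_poly (@polyC F).
pose con : {rmorphism {poly F} -> {poly {poly F}}} := @polyC {poly F}.
pose z (x : Tb + Tk) (i : 'I_d.+1) : {poly {poly F}} :=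
  match x with inl y => chi 'X ^+ (i * p ^ pos y) | inr y => con 'X ^+ (i * p ^ pos y) end.
have iotaE (a : F) : chi a%:P = a%:P%:P by rewrite /chi /= map_polyC.
have -> : S_d F beta k d = \sum_(c : {ffun 'I_d -> F}) \prod_(x : Tb + Tk)
    \sum_i (con \o polyC) (full_coef c i) ^+ (p ^ e x) * z x i.
  apply: eq_bigr => c _; rewrite big_sumType /=; congr (_ * _).
    rewrite -[chi_t _]/(chi (monic_of c)) (exp_tokens p_gt1 _ (lt_pX beta)).
    apply: eq_bigr => x _; rewrite expX_pchar_monic //; apply: eq_bigr => i _ /=.
    by rewrite -iotaE.
  rewrite -[(monic_of c)%:P]/(con (monic_of c)) (exp_tokens p_gt1 _ (lt_pX k)).
  by apply: eq_bigr => x _; rewrite expX_pchar_monic.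
rewrite (@expand_product F _ (con \o polyC : {rmorphism F -> {poly {poly F}}}) _ d (fun x => p ^ e x)%N).
rewrite big1 // => f _.
have [/existsP[i bad]|] := boolP [exists i : 'I_d,
    ~~ ((0 < \sum_x (f x == i :> nat) * p ^ e x) && (#|F|.-1 %| \sum_x (f x == i :> nat) * p ^ e x))%N].
  by rewrite (bigD1 i) //= power_sum0 // rmorph0 !mul0r.
rewrite negb_exists => /forallP good; exfalso.
(* If no factor vanishes, each free coefficient receives a cost of at least q - 1. *)
have: (\sum_(i < d) (p ^ n).-1 <= \sum_(x : Tb + Tk) p ^ (e x %% n))%N.
  apply: leq_trans (sum_fibers_le f _); apply: leq_sum => i _.
  have := good i; rewrite negbK cardF.
  by have [-> ->] := fiber_cost n p_gt1 e (fun x => f x == i :> nat); case/andP => c_gt0 c_dvd; apply: dvdn_leq.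
rewrite sum_nat_const card_ord leqNgt; case/negP; apply: leq_trans small.
rewrite big_sumType /= -(sum_cost_tokens p_gt1 n_gt0 (lt_pX beta)).
by rewrite -(sum_cost_tokens p_gt1 n_gt0 (lt_pX k)).
Qed.

Lemma digit_tokens_fiber m B b :
  (#|[pred x : token B (digit p m) | pos x == b]| < p)%N.
Proof.
have p_gt0 := ltnW p_gt1.
have -> : #|[pred x : token B (digit p m) | pos x == b]| =
    (\sum_(c < B) (c == b :> nat) * digit p m c)%N.
  rewrite -sum1_card big_mkcond (eq_bigr (fun x : token B (digit p m) => (pos x == b) : nat)).
    rewrite (@sum_token B (digit p m) (fun c s => (c == b) : nat)).
    by apply: eq_bigr => c _; rewrite sum_nat_const card_ord mulnC.
  by move=> x _; rewrite inE; case: eqP.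
have [lt_bB|le_Bb] := ltnP b B; last first.
  by rewrite big1 // => c _; rewrite ltn_eqF // (leq_trans (ltn_ord c)).
rewrite (bigD1 (Ordinal lt_bB)) //= eqxx mul1n big1 ?addn0 ?ltn_mod // => c.
by rewrite -val_eqE /= => /negPf->.
Qed.

Section NonVanishing.
Variables (m D R : nat).
Hypotheses (R_lt : (R < (p ^ n).-1)%N)
  (digsum_m : digsum (p ^ n) m = (D * (p ^ n).-1 + R)%N)
  (digsum_rot : forall i, (D * (p ^ n).-1 <= digsum (p ^ n) (p ^ i * m))%N).

Let B := m.
Let cnt := digit p m.
Let lt_m : (m < p ^ B)%N. Proof. exact: lt_pX. Qed.
Let tok := token B cnt.
Let C := carries p D (fun j => tail n B cnt j 0).

Let carriesC : [/\ C 0 = 0%N, C n = 0%N & forall j, (j < n)%N ->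
  (tail n B cnt j 0 + C j = (R %/ p ^ j) %% p + D * p.-1 + p * C j.+1)%N].
Proof.
apply: carriesP => // [|i].
  rewrite (tail_sum n_gt0 B cnt (fun j => p ^ j)%N) -digsum_m -[m in digsum _ m]mul1n -(expn0 p).
  by rewrite (digsum_mulX 0 p_gt1 n_gt0 lt_m); apply: eq_bigr => b _; rewrite addn0.
rewrite (tail_sum n_gt0 B cnt (fun j => p ^ ((j + i) %% n))%N).
have := digsum_rot i; rewrite (digsum_mulX i p_gt1 n_gt0 lt_m).
by under [X in _ -> (_ <= X)%N]eq_bigr do rewrite modnDml.
Qed.

Let R_lt' : (R < p ^ n)%N.
Proof. by apply: leq_trans R_lt _; rewrite leq_pred. Qed.
Let cnt_lt b : (cnt b < p)%N. Proof. by rewrite ltn_mod ltnW. Qed.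
Let cnt0 b : (B <= b)%N -> cnt b = 0%N. Proof. exact: digit_ge. Qed.

Definition degree (f : {ffun tok -> 'I_D.+1}) := (\sum_x f x * p ^ pos x)%N.
Definition validb (f : {ffun tok -> 'I_D.+1}) :=
  [forall l : 'I_D, \sum_x (f x == l :> nat) * cost p n x == (p ^ n).-1]%N.

Lemma validP (f : {ffun tok -> 'I_D.+1}) : reflect (valid p n f) (validb f).
Proof.
apply: (iffP forallP) => [H l lt_l|H l]; first exact: eqP (H (Ordinal lt_l)).
by apply/eqP; apply: H.
Qed.

Lemma wt_degree (f : {ffun tok -> 'I_D.+1}) : wt p f = (degree f + \sum_(x : tok) p ^ pos x)%N.
Proof. by rewrite -big_split; apply: eq_bigr => x _ /=; rewrite mulSn addnC. Qed.

(** The free groups cost positive multiples of q - 1 within a total of D(q - 1) + R, hence exactly q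
    - 1 each, and each contributes a factor -1. *)
Lemma monic_power_sum : \sum_(c : {ffun 'I_D -> F}) monic_of c ^+ m =
  (-1) ^+ D * \sum_(f | validb f) 'X^(degree f).
Proof.
pose iota := (@polyC F : {rmorphism F -> {poly F}}).
transitivity (\sum_(c : {ffun 'I_D -> F}) \prod_(x : tok)
    \sum_i iota (full_coef c i) ^+ (p ^ pos x) * 'X ^+ (i * p ^ pos x)).
  apply: eq_bigr => c _; rewrite (exp_tokens p_gt1 _ lt_m); apply: eq_bigr => x _.
  by rewrite (@expX_pchar_monic F _ idfun).
rewrite (@expand_product F _ iota _ D (fun x => p ^ pos x)%N (fun x i => 'X ^+ (i * p ^ pos x))).
rewrite big_distrr [RHS]big_mkcond; apply: eq_bigr => f _ /=.
have tot : (\sum_(i < D) \sum_x (f x == i :> nat) * cost p n x <= D * (p ^ n).-1 + R)%N.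
  by apply: leq_trans (sum_fibers_le f _) _; rewrite (sum_cost_tokens p_gt1 n_gt0 lt_m) digsum_m.
have fib (i : 'I_D) := fiber_cost n p_gt1 (@pos B cnt) (fun x => f x == i :> nat).
case: ifP => [/forallP vf|/negbT nvf].
  rewrite prodrXr; congr (_ * _).
  rewrite -[D in RHS]card_ord -prodr_const; apply: eq_bigr => i _.
  rewrite power_sumN1 ?rmorphN1 // ?cardF; have [e1 e2] := fib i.
    by rewrite e1 -/(cost p n _) (eqP (vf i)); apply: leq_ltn_trans R_lt.
  by rewrite e2 (eqP (vf i)).
have [/existsP[i bad]|] := boolP [exists i : 'I_D,
    ~~ ((0 < \sum_x (f x == i :> nat) * p ^ pos x) && (#|F|.-1 %| \sum_x (f x == i :> nat) * p ^ pos x))%N].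
  by rewrite (bigD1 i) //= power_sum0 // rmorph0 !mul0r.
rewrite negb_exists => /forallP good; exfalso; case/negP: nvf; apply/forallP => l.
have cl (i : 'I_D) : exists2 k, (0 < k)%N & (\sum_x (f x == i :> nat) * cost p n x)%N = (k * (p ^ n).-1)%N.
  have := good i; rewrite negbK cardF; have [-> ->] := fib i.
  case/andP => c0 /dvdnP[k ek]; exists k => //; rewrite lt0n; apply/eqP => k0.
  by move: c0; rewrite [X in (0 < X)%N]ek k0.
(* A group costing 2(q - 1) or more would push the total beyond D(q - 1) + R. *)
have [k k0 ek] := cl l; rewrite ek; have [-> //|k1] := eqVneq k 1%N; first by rewrite mul1n.
have: (\sum_(i < D) ((p ^ n).-1 + (i == l) * (p ^ n).-1) <=
       \sum_(i < D) \sum_x (f x == i :> nat) * cost p n x)%N.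
  apply: leq_sum => i _; have [->|_] := eqVneq i l.
    by rewrite ek mul1n addnn -mul2n leq_mul2r; apply/orP; right; lia.
  by have [k' k'0 ->] := cl i; rewrite addn0 leq_pmull.
rewrite big_split /= sum_nat_const card_ord (bigD1 l) //= eqxx mul1n => H; exfalso.
by have := leq_trans H tot; move: (\sum_(_ < _ | _) _)%N R_lt; move: ((p ^ n).-1) => *; lia.
Qed.

Lemma monic_power_sum_neq0 : \sum_(c : {ffun 'I_D -> F}) monic_of c ^+ m != 0.
Proof.
have [C0 Cn tC] := carriesC.
have [f0 vf0] := valid_exists (B := B) (cnt := cnt) p_gt1 n_gt0 cnt0 R_lt' C0 Cn tC.
have vf1 : validb [ffun x => f0 x].
  by apply/validP => l lt_l; rewrite -(vf0 l lt_l); apply: eq_bigr => x _; rewrite ffunE.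
have [fm vfm max_fm] := @arg_maxnP _ [ffun x => f0 x] validb degree vf1.
pose O := [set f | validb f && (degree f == degree fm)].
have opt f : f \in O -> forall h : tok -> 'I_D.+1, valid p n h -> (wt p h <= wt p f)%N.
  rewrite inE => /andP[_ /eqP ef] h vh.
  have -> : wt p h = wt p [ffun x => h x] by apply: eq_bigr => x _; rewrite ffunE.
  rewrite (wt_degree f) (wt_degree [ffun x => h x]) leq_add2r ef; apply: max_fm.
  by apply/validP => l lt_l; rewrite -(vh l lt_l); apply: eq_bigr => x _; rewrite ffunE.
have card_O : ~~ (p %| #|O|)%N.
  apply: (same_counts_card (pos := @pos B cnt) p_pr).
  - exact: digit_tokens_fiber.
  - by apply/set0Pn; exists fm; rewrite inE vfm eqxx.
  - move=> f s; rewrite !inE => /andP[/validP vf /eqP ef] /forallP hs.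
    have pos_s x : pos (s x) = pos x by apply/eqP.
    apply/andP; split.
      apply/validP => l lt_l; rewrite -(vf l lt_l) (reindex_inj (@perm_inj _ s)).
      by apply: eq_bigr => x _; rewrite ffunE permK /cost pos_s.
    rewrite -ef; apply/eqP; rewrite /degree (reindex_inj (@perm_inj _ s)).
    by apply: eq_bigr => x _; rewrite ffunE permK pos_s.
  - move=> f g fO gO b l; have := fO; have := gO; rewrite !inE => /andP[/validP vg _] /andP[/validP vf _].
    have := optimal_counts p_gt1 n_gt0 cnt_lt cnt0 R_lt' C0 Cn tC vf vg (opt f fO) (opt g gO) b l.
    have E (h : {ffun tok -> 'I_D.+1}) : #|[pred x | (h x == l) && (pos x == b)]| =
        (\sum_x (h x == l :> nat) * (pos x == b))%N.
      rewrite -sum1_card big_mkcond; apply: eq_bigr => x _; rewrite inE -val_eqE /=.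
      by do 2!case: eqP.
    by rewrite !E.
(* The coefficient at the maximal degree is (-1)^D times the number of optimal distributions. *)
apply/eqP => /(congr1 (fun q : {poly F} => q`_(degree fm))).
rewrite monic_power_sum -polyC1 -polyCN -polyC_exp mul_polyC coefZ coef0 coef_sum.
move/eqP; rewrite mulf_eq0 expf_eq0 oppr_eq0 oner_eq0 andbF /=.
rewrite (eq_bigr (fun f => (degree fm == degree f)%:R)); last by move=> f _; rewrite coefXn.
rewrite -natr_sum -(dvdn_pcharf pF) => dvd_O; case/negP: card_O.
move: dvd_O; congr (_ %| _)%N; rewrite -sum1_card big_mkcond [RHS]big_mkcond.
by apply: eq_bigr => f _; rewrite inE [degree f == _]eq_sym; do 2!case: ifP => //=; case: eqP.
Qed.

End NonVanishing.
End Main.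

(** * Reduction to one variable and to the minimizing rotation *)

Section Reductions.
Variables (F : finFieldType) (p n : nat).
Hypotheses (p_pr : prime p) (n_gt0 : (0 < n)%N) (cardF : #|F| = (p ^ n)%N).

Let p_gt1 : (1 < p)%N. Proof. exact: prime_gt1. Qed.
Let pF : p \in [pchar F]. Proof. exact: card_finPcharP cardF p_pr. Qed.
Let pPF : p \in [pchar {poly F}]. Proof. by rewrite pchar_poly. Qed.
Let pPPF : p \in [pchar {poly {poly F}}]. Proof. by rewrite pchar_poly. Qed.

Lemma expf_cardX (a : F) N : a ^+ (p ^ (n * N)) = a.
Proof.
by elim: N => [|N IHN]; rewrite ?muln0 ?expr1 // mulnS expnD exprM -cardF expf_card.
Qed.

(** At t = theta^(q^N), chi_t(a) becomes a^(q^N), since the q-th power fixes the coefficients in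
    F. *)
Lemma S_d_eval beta k d N : (S_d F beta k d).['X^(p ^ (n * N))] =
  \sum_(c : {ffun 'I_d -> F}) monic_of c ^+ (k + p ^ (n * N) * beta).
Proof.
rewrite horner_sum; apply: eq_bigr => c _.
rewrite hornerM !horner_exp hornerC mulrC exprD exprM; congr (_ * _ ^+ _).
rewrite (@expX_pchar_monic F _ idfun) // /chi_t monic_of_full.
rewrite [map_poly _ _]rmorph_sum horner_sum; apply: eq_bigr => i _.
rewrite rmorphM /= rmorphXn /= map_polyC map_polyX hornerM hornerC horner_exp hornerX.
by rewrite -polyC_exp expf_cardX -exprM mulnC.
Qed.

Lemma S_d_frob i beta k d :
  S_d F (p ^ i * beta) (p ^ i * k) d = S_d F beta k d ^+ (p ^ i).
Proof.
rewrite /S_d sum_exp_pchar //; apply: eq_bigr => c _.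
by rewrite exprMn -!exprM ![(_ * p ^ i)%N]mulnC.
Qed.

Let quot beta k i := ((digsum (p ^ n) (p ^ i * beta) + digsum (p ^ n) (p ^ i * k)) %/ (p ^ n - 1))%N.

Lemma quot_mod beta k i : quot beta k (i %% n) = quot beta k i.
Proof.
have E m : digsum (p ^ n) (p ^ (i %% n) * m) = digsum (p ^ n) (p ^ i * m).
  have lt_m : (m < p ^ m)%N by apply: ltn_expl.
  rewrite !(digsum_mulX _ p_gt1 n_gt0 lt_m); apply: eq_bigr => b _.
  by rewrite modnDmr.
by rewrite /quot !E.
Qed.

Lemma phi_le beta k i : (phi p n beta k <= quot beta k i)%N.
Proof.
rewrite -quot_mod /phi; have lt_i := ltn_pmod i n_gt0.
have: Ordinal lt_i \in index_enum 'I_n by rewrite mem_index_enum.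
rewrite -[(i %% n)%N]/(val (Ordinal lt_i)); move: (Ordinal lt_i) => j.
elim: (index_enum _) => // l s IHs; rewrite inE big_cons geq_min => /orP[/eqP->|/IHs->].
  by rewrite leqnn.
by rewrite orbT.
Qed.

Lemma phi_attained beta k : exists i, phi p n beta k = quot beta k i.
Proof.
rewrite /phi; apply: (big_ind (fun v => exists i, v = quot beta k i)) => [|x y [i ->] [j ->]|i _]; last by exists i.
  (* The default value of the minimum is the term at i = 0. *)
  by exists 0%N; rewrite /quot expn0 !mul1n.
by rewrite /minn; case: ifP => _; [exists i|exists j].
Qed.

Lemma exact_degree beta k : is_exact_degree_z F beta k (phi p n beta k).
Proof.
have q_gt1 : (1 < p ^ n)%N by rewrite -(exp1n n) ltn_exp2r.
have q1_gt0 : (0 < p ^ n - 1)%N by rewrite subn_gt0.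
have [i ei] := phi_attained beta k.
(* The sum for the rotated exponents is a power of the original one, so vanishing may be tested
   where the minimum is attained. *)
have frob d : (S_d F beta k d == 0) = (S_d F (p ^ i * beta) (p ^ i * k) d == 0).
  by rewrite S_d_frob expf_eq0 expn_gt0 ltnW.
split; last first.
  move=> d; rewrite ei ltn_divLR // subn1 => lt_d; apply/eqP; rewrite frob.
  by rewrite (S_d_vanish p_pr n_gt0 cardF lt_d).
rewrite frob; set D := phi p n beta k; set b := (p ^ i * beta)%N; set l := (p ^ i * k)%N.
(* The digits of l fit below position n * l, so those of b can be placed above them and the digit
   sums add up. *)
have lt_l : (l < p ^ (n * l))%N.
  by apply: leq_trans (ltn_expl l p_gt1) _; rewrite leq_exp2l // leq_pmull.
have sum_rot j : digsum (p ^ n) (p ^ j * (l + p ^ (n * l) * b)) =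
    (digsum (p ^ n) (p ^ (j + i) * beta) + digsum (p ^ n) (p ^ (j + i) * k))%N.
  by rewrite (digsum_addX j p_gt1 n_gt0 lt_l (ltn_expl b p_gt1)) addnC !expnD -!mulnA.
suff: \sum_(c : {ffun 'I_D -> F}) monic_of c ^+ (l + p ^ (n * l) * b) != 0.
  by rewrite -S_d_eval; apply: contraNN => /eqP->; rewrite horner0.
pose R := ((digsum (p ^ n) b + digsum (p ^ n) l) %% (p ^ n).-1)%N.
apply: (monic_power_sum_neq0 p_pr n_gt0 cardF (R := R)).
- by rewrite ltn_mod -subn1.
- by rewrite -[(l + _)%N]mul1n -(expn0 p) sum_rot add0n /D ei /quot subn1 -divn_eq.
- move=> j; rewrite sum_rot -subn1 -leq_divRL //; exact: phi_le.
Qed.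

End Reductions.

Local Close Scope ring_scope.

Theorem theorem3p1p1 (F : finFieldType) (p n : nat) (beta k : nat) :
  prime p -> (0 < n)%N -> #|F| = (p ^ n)%N ->
  (0 < beta)%N -> (0 < k)%N ->
  is_exact_degree_z F beta k (phi p n beta k).
Proof. by move=> p_pr n_gt0 cardF _ _; apply: exact_degree. Qed.
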